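(* Assume $s=d$ and $\beta>d^{d/2}2^{2d+1}(d+1)\log 2$. Then $G(X^{(n)})$ is connected with probability tending to $1$ as $n\to\infty$. Moreover, with probability tending to $1$ the diameter $\mathsf{diam}\,G(X^{(n)})$ is stochastically dominated by an affine function of the total progeny of a subcritical Galton–Watson process: precisely, there exists a coupling between $X^{(n)}$ and the total progeny $T$ of a subcritical Galton–Watson process such that $\mathbb{P}(\mathsf{diam}\,G(X^{(n)})>2+2^dT)\in O(n^{-1})$.
   Context: Fix an integer $d\ge2$. For $n\ge1$, $\mathbb{T}_n$ is the torus obtained from $[-n/2,n/2]^d$ by identifying opposite faces, with toroidal distance ${\rm d}_{\mathbb{T}_n}$ and $B^{\mathbb{T}_n}_r(\xi)=\{\eta\in\mathbb{T}_n:{\rm d}_{\mathbb{T}_n}(\xi,\eta)\le r\}$. $R$ is a nonnegative random variable with absolutely continuous distribution such that $\lim_{h\to\infty}h^s\mathbb{P}(R>h)=\beta$ for some $\beta,s\in(0,\infty)$. $X^{(n)}$ is a homogeneous Poisson point process of intensity $1$ on $\mathbb{T}_n$, each point independently marked with a mark in $[0,\infty)$ distributed as $R$ (points written $(\xi,r)$). The scale-free Gilbert graph $G(X^{(n)})$ has vertex set $X^{(n)}$ and a directed edge from $(\xi,r)$ to $(\eta,t)$ whenever $\eta\in B^{\mathbb{T}_n}_r(\xi)$. Connectivity and diameter refer to the graph with edges traversable in either direction (the diameter is the maximal chemical distance, i.e. minimal number of hops, between two vertices). *)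

(* Defs.v *)
From HB Require Import structures.
From mathcomp Require Import all_boot all_order all_algebra.
From mathcomp Require Import all_classical all_reals all_analysis.
Set Implicit Arguments. Unset Strict Implicit. Unset Printing Implicit Defensive.
Import Order.TTheory GRing.Theory Num.Theory.
Import numFieldNormedType.Exports.
Local Open Scope classical_set_scope.
Local Open Scope ring_scope.

(* distance from t to the lattice nZ, i.e. the one-dimensional toroidal
   distance |t|_{R / nZ} *)
Definition circ_dist {R : realType} (n : nat) (t : R) : R :=
  let u := t / n%:R - ((Num.floor (t / n%:R))%:~R) in
  n%:R * Num.min u (1 - u).

Definition torus_dist {R : realType} {dim : nat} (n : nat) (x y : 'I_dim -> R) : R :=
  Num.sqrt (\sum_(c < dim) (circ_dist n (x c - y c)) ^+ 2).

(* a marked point (xi, r) : location xi in R^dim, mark r *)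
Definition mpoint (R : realType) (dim : nat) := (('I_dim -> R) * R)%type.

(* undirected adjacency: an edge (in one of the two directions) of G(X):
   (xi,r) -> (eta,t) iff eta \in B_r(xi) *)
Definition gadj {R : realType} {dim : nat} (n : nat) (X : seq (mpoint R dim))
  : rel 'I_(size X) :=
  fun i j =>
    let p := nth ((fun _ => 0), 0) X i in
    let q := nth ((fun _ => 0), 0) X j in
    (torus_dist n p.1 q.1 <= p.2) || (torus_dist n q.1 p.1 <= q.2).
Arguments gadj {R dim} n X.

Definition gconnected {R : realType} {dim : nat} (n : nat) (X : seq (mpoint R dim))
  : Prop := forall i j : 'I_(size X), connect (gadj n X) i j.

Definition chem_dist_le {R : realType} {dim : nat} (n : nat) (X : seq (mpoint R dim))
  (i j : 'I_(size X)) (k : nat) : Prop :=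
  exists p : seq 'I_(size X),
    (size p <= k)%N /\ path (gadj n X) i p /\ last i p = j.

(* diam G(X) <= k  (diameter = max chemical distance; +oo if disconnected) *)
Definition diam_le {R : realType} {dim : nat} (n : nat) (X : seq (mpoint R dim))
  (k : nat) : Prop :=
  forall i j : 'I_(size X), chem_dist_le n i j k.

Definition mutually_independent {d} {T : measurableType d} {R : realType}
  (P : probability T R) {I : eqType} (F : I -> set (set T)) : Prop :=
  forall (J : seq I) (A : I -> set T), uniq J ->
    (forall i, i \in J -> F i (A i)) ->
    P (\big[setI/setT]_(i <- J) A i) = (\prod_(i <- J) P (A i))%E.

Definition rv_events {d} {T : measurableType d} {R : realType}
  (X : T -> R) : set (set T) :=
  [set A | exists2 B : set R, measurable B & A = X @^-1` B].

Definition nat_rv_events {T : Type} (X : T -> nat) : set (set T) :=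
  [set A | exists B : set nat, A = X @^-1` B].

(* X^(n) = [(U_1,M_1); ...; (U_N,M_N)] where N ~ Poisson(n^dim)
   (= Poisson(Leb(T_n)), intensity 1), the U_i are i.i.d. uniform on
   [-n/2,n/2]^dim (given by i.i.d. uniform coordinates U i c), the marks
   M_i are i.i.d. with law muR, and everything is independent. *)
Definition marked_config {T : Type} {R : realType} (dim : nat)
  (N : T -> nat) (U : nat -> 'I_dim -> T -> R) (M : nat -> T -> R) (w : T)
  : seq (mpoint R dim) :=
  [seq ((fun c => U i c w), M i w) | i <- iota 0 (N w)].

Definition ppp_index (dim : nat) := option (nat * option 'I_dim).

Definition is_marked_PPP {d} {T : measurableType d} {R : realType}
  (P : probability T R) (dim n : nat) (muR : probability R R)
  (N : T -> nat) (U : nat -> 'I_dim -> T -> R) (M : nat -> T -> R) : Prop :=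
  [/\ (forall k, measurable (N @^-1` [set k])) /\
      (forall i c, measurable_fun setT (U i c)) /\
      (forall i, measurable_fun setT (M i)),
      (forall k, P (N @^-1` [set k]) = (poisson_pmf (n%:R ^+ dim) k)%:E),
      (forall i c (B : set R), measurable B ->
         P (U i c @^-1` B) =
         (lebesgue_measure (B `&` `[(- (n%:R / 2) : R)%R, (n%:R / 2 : R)%R]) * (n%:R^-1)%:E)%E),
      (forall i (B : set R), measurable B -> P (M i @^-1` B) = muR B)
    & mutually_independent P (fun x : ppp_index dim =>
        match x with
        | None => nat_rv_events N
        | Some (i, None) => rv_events (M i)
        | Some (i, Some c) => rv_events (U i c)
        end) ].

Fixpoint gw_gen {T : Type} (xi : nat -> nat -> T -> nat) (t : nat) (w : T)
  : nat :=
  match t with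
  | 0 => 1
  | t'.+1 => \sum_(j < gw_gen xi t' w) xi t' j w
  end.

Definition gw_total_progeny {T : Type} (xi : nat -> nat -> T -> nat)
  (w : T) (m : nat) : Prop :=
  exists t0, gw_gen xi t0 w = 0%N /\ (\sum_(t < t0) gw_gen xi t w)%N = m.

Definition subcritical_offspring {R : realType} (p : nat -> R) : Prop :=
  (forall k, 0 <= p k) /\
  (\sum_(0 <= k <oo) (p k)%:E = 1%:E)%E /\
  (\sum_(0 <= k <oo) (k%:R * p k)%:E < 1%:E)%E.

Definition is_GW_family {d} {T : measurableType d} {R : realType}
  (P : probability T R) (p : nat -> R) (xi : nat -> nat -> T -> nat) : Prop :=
  [/\ (forall t j k, measurable (xi t j @^-1` [set k])),
      (forall t j k, P (xi t j @^-1` [set k]) = (p k)%:E)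
    & mutually_independent P (fun x : nat * nat => nat_rv_events (xi x.1 x.2)) ].

Arguments is_marked_PPP {d T R} P dim n muR N U M.
Arguments marked_config {T R dim} N U M w.
Arguments is_GW_family {d T R} P p xi.
Arguments chem_dist_le {R dim} n X i j k.
Arguments diam_le {R dim} n X k.
Arguments gconnected {R dim} n X.

(* Main.v *)
Require Import Defs.
From HB Require Import structures.
From mathcomp Require Import all_boot all_order all_algebra.
From mathcomp Require Import all_classical all_reals all_analysis measurable_realfun.
From mathcomp Require Import ring lra zify.
Import Order.TTheory GRing.Theory Num.Theory.
Import numFieldNormedType.Exports.
Local Open Scope classical_set_scope.
Local Open Scope ring_scope.

(** Cut the torus into dyadic boxes. A vertex of a level-j box whose radius exceeds
    the diameter of two such boxes reaches every point of the neighbouring boxes of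
    level j. If every level-k box lies in an ancestor box containing such a vertex,
    these vertices of touching level-k boxes are adjacent, so walking along the grid
    of level-k boxes bounds the diameter by 2 + 2^k. For a fixed level-k box the
    Poisson void probability of its k ancestors decays like a large negative power of
    2^k, uniformly as long as the boxes have side at least a constant, because
    n^d P(R > r) is of order (n/r)^d; this beats the number 2^(kd) of boxes. Taking k
    fixed gives connectivity. Taking k as large as possible, of order log n, the
    failure probability is O(1/n), and the least k that works has 2^k dominated by a
    random variable of polynomial tail and mean < 1; this variable is coupled to the
    offspring number of the root, hence to a lower bound of the total progeny. *)

(** * Lebesgue measure as a source of fair coins *)

(** At level j the radius is r = 2 sqrt(d) n / 2^j and the region used has volume n^d / 2^(jd+1), so
    it holds on average P(R > r) r^d / (2 (2 sqrt(d))^d) large vertices; for large r the bound on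
    beta makes this at least 2^d (d+1) log 2. Since 2^d (d+1) >= d + 5, a union bound over the
    2^(kd) boxes leaves a failure probability of at most 2^(-5k). The offspring law is explicit and
    the same for all n, because the total progeny enters only through T >= 1 + (offspring of the
    root). The obstacle is the coupling: one probability space must carry the Poisson process, a
    function of it that is dominated by the offspring of the root, and fresh randomness completing
    that function to a Galton-Watson family. The space is the unit interval: binary digits in odd
    positions produce the process, those in even positions everything else. Connectivity, by
    contrast, is shown for every realization of the process. *)

Lemma measurable_preimage {d d'} {T : measurableType d} {T' : measurableType d'}
    {X : T -> T'} {A : set T'} :
  measurable_fun setT X -> measurable A -> measurable (X @^-1` A).
Proof. by move=> mX mA; rewrite -[_ @^-1` _]setTI; exact: mX. Qed.

Section law_ext.
Context {d : measure_display} {T : measurableType d} {R : realType}.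
Variable P : probability T R.

(** Both sides are finite measures in [B] that agree on right half-lines, a generating pi-system.
    The event [D] and the factor [c] allow one event to be held fixed while the other varies, which
    is how independence is proved below. *)
Lemma law_ext (D : set T) (X : T -> R) (c : R) (Q : probability R R) :
  measurable D -> measurable_fun setT X -> 0 <= c -> P D = c%:E ->
  (forall x, P (D `&` X @^-1` `]-oo, x]%classic) = (c%:E * Q `]-oo, x]%classic)%E) ->
  forall B, measurable B -> P (D `&` X @^-1` B) = (c%:E * Q B)%E.
Proof.
move=> mD mX c0 PD PX B mB.
have mXP A : measurable A -> measurable (D `&` X @^-1` A).
  by move=> mA; apply: measurableI => //; exact: (measurable_preimage mX mA).
pose m1 : {measure set R -> \bar R} :=
  measure_function_pushforward__canonical__measure_function_Measure (mrestr P mD) mX.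
pose m2 : {measure set R -> \bar R} := mscale (NngNum c0) Q.
have m1E A : m1 A = P (D `&` X @^-1` A).
  by rewrite /m1 /= /pushforward /mrestr setIC.
have m2E A : m2 A = (c%:E * Q A)%E by [].
rewrite -m1E -m2E.
apply: (@measure_unique _ _ _ (@RGenOInfty.G R) (fun k => `]- k%:R, +oo[%classic)) => //.
- exact: RGenOInfty.measurableE.
- move=> _ _ [x ->] [y ->]; exists (Num.max x y).
  by apply/seteqP; split => z /=; rewrite !in_itv/= !andbT gt_max => /andP.
- by move=> k; exists (- k%:R).
- apply/seteqP; split => // x _; exists (Num.truncn `|x|).+1 => //=.
  rewrite in_itv/= andbT ltrNl.
  by apply: le_lt_trans (truncnS_gt _); rewrite -normrN ler_norm.
- move=> _ [x ->]; rewrite m1E m2E.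
  pose C : set R := `]-oo, x]%classic.
  have mC : measurable C by exact: measurable_itv.
  have -> : `]x, +oo[%classic = ~` C by rewrite setCitvl.
  have PDy : (P D < +oo)%E by rewrite PD ltry.
  rewrite (_ : X @^-1` (~` C) = ~` (X @^-1` C))// -setDE measureD//; last first.
    exact: (measurable_preimage mX mC).
  transitivity (P D - c%:E * Q C)%E; first by congr (_ - _)%E; exact: PX.
  by rewrite PD probability_setC// muleBr ?fin_num_adde_defr// mule1.
- move=> k; rewrite m1E; apply: (@le_lt_trans _ _ 1%E); last exact: ltry.
  by apply: probability_le1; exact: mXP.
Qed.

End law_ext.

(* [uniform_prob] lives on [measurableTypeR R], whose measurable structure has
   the same measurable sets as the canonical one of [R] but is not the same
   record. *)
Definition uniform_law {R : realType} {a b : R} (ab : a < b) (B : set R) : \bar R :=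
  uniform_prob ab B.

Section uniform_law_measure.
Context {R : realType} {a b : R} (ab : a < b).

Let uniform_law0 : uniform_law ab set0 = 0%E.
Proof. exact: measure0. Qed.

Let uniform_law_ge0 (B : set R) : (0 <= uniform_law ab B)%E.
Proof. exact: measure_ge0. Qed.

Let uniform_law_sigma_additive : semi_sigma_additive (uniform_law ab).
Proof. exact: (@measure_semi_sigma_additive _ _ _ (uniform_prob ab)). Qed.

HB.instance Definition _ := isMeasure.Build _ _ _ (uniform_law ab)
  uniform_law0 uniform_law_ge0 uniform_law_sigma_additive.

Let uniform_lawT : uniform_law ab setT = 1%:E.
Proof. exact: (@probability_setT _ _ _ (uniform_prob ab)). Qed.

HB.instance Definition _ := @Measure_isProbability.Build _ _ R (uniform_law ab) uniform_lawT.

Lemma uniform_lawE (B : set R) : measurable B ->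
  uniform_law ab B = (lebesgue_measure (B `&` `[a, b]) * ((b - a)^-1)%:E)%E.
Proof.
move=> mB; rewrite /uniform_law /uniform_prob integral_uniform_pdf.
rewrite (eq_integral (fun=> ((b - a)^-1)%:E)); last first.
  by move=> x; rewrite inE/= in_itv/= /uniform_pdf => -[_ ->].
by rewrite integral_cst//= 1?muleC//; exact: measurableI.
Qed.

End uniform_law_measure.

Definition unit_prob {R : realType} : probability R R := uniform_law (@ltr01 R).

Section unit_interval.
Context {R : realType}.
Implicit Types (x : R) (B : set R).

Lemma unit_lawE B : measurable B -> unit_prob B = lebesgue_measure (B `&` `[0, 1]).
Proof. by move=> mB; rewrite /unit_prob /= uniform_lawE// subr0 invr1 mule1. Qed.

Definition clamp x : R := if x <= 0 then 0 else if x <= 1 then x else 1.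

Lemma unit_law_itv (b1 b2 : bool) (u v : R) : 0 <= u -> v <= 1 -> u <= v ->
  unit_prob [set` Interval (BSide b1 u) (BSide b2 v)] = (v - u)%:E.
Proof.
move=> u0 v1 uv; rewrite unit_lawE// (setIidl _).
  rewrite lebesgue_measure_itv/= lte_fin.
  by case: ltP => // vu; have -> : v - u = 0 by lra.
move=> x /=; rewrite !in_itv/=.
by case: b1; case: b2 => /=; lra.
Qed.

Lemma unit_law_cdf x : unit_prob `]-oo, x]%classic = (clamp x)%:E.
Proof.
rewrite unit_lawE// /clamp.
have -> : `]-oo, x] `&` `[0, 1] = `[0, Num.min 1 x]%classic :> set R.
  apply/seteqP; split => z /=; rewrite !in_itv/= le_min.
    by move=> [-> /andP[-> ->]].
  by move=> /and3P[-> -> ->].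
rewrite lebesgue_measure_itv/= lte_fin -EFinD subr0 minEle.
by case: (leP 1 x) => ?; do ! case: leP => ?; congr EFin; lra.
Qed.

Lemma clamp_itv x : 0 <= clamp x <= 1.
Proof. by rewrite /clamp; case: (leP x 0) => ?; [|case: (leP x 1) => ?]; lra. Qed.

Lemma clamp_le0 x : x <= 0 -> clamp x = 0.
Proof. by rewrite /clamp => ->. Qed.

Lemma clamp_ge1 x : 1 <= x -> clamp x = 1.
Proof. by rewrite /clamp => ?; case: (leP x 0) => ?; [|case: (leP x 1) => ?]; lra. Qed.

Lemma clamp_id x : 0 <= x <= 1 -> clamp x = x.
Proof. by rewrite /clamp => ?; case: (leP x 0) => ?; [|case: (leP x 1) => ?]; lra. Qed.

(** The self-similarity of the uniform distribution function, to be compared with the recursions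
    coming from binary digits. *)
Lemma clamp_halve x : clamp x = 2^-1 * (clamp (2 * x) + clamp (2 * x - 1)).
Proof.
by rewrite /clamp; do ! case: leP => ?; lra.
Qed.

(** The first binary digit; [doubling] is the shift that deletes it from the expansion. *)
Definition coin x : bool := 2^-1 <= x.
Definition doubling x : R := 2 * x - (coin x)%:R.

Lemma measurable_coin : measurable_fun setT coin.
Proof. exact: measurable_fun_ler. Qed.

Lemma measurable_coin_eq e : measurable [set x | coin x = e].
Proof. exact: (measurable_preimage (A := [set e]) measurable_coin). Qed.

Lemma measurable_doubling : measurable_fun setT doubling.
Proof.
apply: measurable_funB; first exact: measurable_funM.
rewrite (_ : (fun x => _) = (fun x => if coin x then 1 else 0)).
  apply: measurable_fun_if => //; exact: measurable_funTS measurable_coin.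
by apply/funext => x; case: coin.
Qed.

(** The first digit is fair and independent of the rest, because the shift maps each half of the
    unit interval affinely onto the whole. *)
Lemma unit_law_coin e B : measurable B ->
  unit_prob ([set y | coin y = e] `&` doubling @^-1` B) = (2^-1%:E * unit_prob B)%E.
Proof.
have mI (i : interval R) : measurable [set` i] by exact: measurable_itv.
have coinT : [set y | coin y = true] = `[2^-1, +oo[%classic.
  by apply/seteqP; split => x /=; rewrite in_itv/= andbT.
have coinF : [set y | coin y = false] = `]-oo, 2^-1[%classic.
  by apply/seteqP; split => x /=; rewrite in_itv/= /coin; case: leP.
apply: law_ext => //; [exact: measurable_coin_eq|exact: measurable_doubling| |].
  case: e; rewrite ?coinT ?coinF unit_lawE//.
    rewrite (_ : _ `&` _ = `[2^-1, 1]%classic).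
      by rewrite lebesgue_measure_itv/= lte_fin ifT; [congr EFin; lra|lra].
    by apply/seteqP; split => x /=; rewrite !in_itv/=; lra.
  rewrite (_ : _ `&` _ = `[0, 2^-1[%classic).
    by rewrite lebesgue_measure_itv/= lte_fin ifT; [congr EFin; lra|lra].
  by apply/seteqP; split => x /=; rewrite !in_itv/=; lra.
move=> x; rewrite unit_law_cdf -EFinM unit_lawE; last first.
  apply: measurableI; first exact: measurable_coin_eq.
  exact: measurable_preimage measurable_doubling _.
case: e.
  rewrite (_ : _ `&` _ = `[2^-1, Num.min 1 ((x + 1) / 2)]%classic); last first.
    apply/seteqP; split => y /=; rewrite !in_itv/= /doubling /coin le_min.
      by move=> [[c d] e]; have c' : 2^-1 <= y by []; move: d; rewrite c /=; lra.
    by move=> /and3P[c ? ?]; rewrite c /=; split; [split => //|]; lra.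
  rewrite lebesgue_measure_itv/= lte_fin -EFinD /clamp minEle.
  by case: (leP 1 ((x + 1) / 2)) => ?; do ! case: leP => ?; try (congr EFin; lra).
have [x1|x1] := ltP x 1.
  rewrite (_ : _ `&` _ = `[0, x / 2]%classic); last first.
    apply/seteqP; split => y /=; rewrite !in_itv/= /doubling /coin.
      by move=> [[c d] e]; move: d; rewrite c /=; lra.
    move=> yx; have c : (2^-1 <= y) = false by apply/negbTE; rewrite -ltNge; lra.
    by rewrite c /=; split; [split => //|]; lra.
  rewrite lebesgue_measure_itv/= lte_fin -EFinD /clamp.
  by case: (ltP 0 (x / 2)) => ?; do ! case: leP => ?; try (congr EFin; lra).
rewrite (_ : _ `&` _ = `[0, 2^-1[%classic); last first.
  apply/seteqP; split => y /=; rewrite !in_itv/= /doubling /coin.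
    move=> [[c d] e]; have c' : y < 2^-1 by rewrite ltNge c.
    by lra.
  move=> yx; have c : (2^-1 <= y) = false by apply/negbTE; rewrite -ltNge; lra.
  by rewrite c /=; split; [split => //|]; lra.
rewrite lebesgue_measure_itv/= lte_fin -EFinD /clamp.
by case: ltP => ?; do ! case: leP => ?; try (congr EFin; lra).
Qed.

Lemma unit_law_doubling B : measurable B -> unit_prob (doubling @^-1` B) = unit_prob B.
Proof.
move=> mB; have mc := measurable_coin_eq.
have mD := measurable_preimage measurable_doubling mB.
have -> : doubling @^-1` B = ([set y | coin y = true] `&` doubling @^-1` B) `|`
    ([set y | coin y = false] `&` doubling @^-1` B).
  by apply/seteqP; split => x /=; [case: coin; tauto|tauto].
rewrite measureU; first last.
- by apply/seteqP; split => x //= -[[-> _] [? _]].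
- exact: measurableI.
- exact: measurableI.
rewrite [X in (X + _)%E]unit_law_coin// [X in (_ + X)%E]unit_law_coin//.
rewrite -muleDl//.
by rewrite -EFinD (_ : 2^-1 + 2^-1 = 1 :> R) ?mul1e//; lra.
exact: fin_num_measure.
Qed.

(** For x = 0.b1b2b3... this is 0.b1b3b5... cut after [n] digits; the double shift skips the even
    positions. *)
Fixpoint odd_bits_rec n x : R :=
  if n is n'.+1 then ((coin x)%:R + odd_bits_rec n' (doubling (doubling x))) / 2
  else 0.

Lemma odd_bits_rec_itv n x : 0 <= odd_bits_rec n x <= 1.
Proof.
elim: n x => [|n IH] x /=; first by rewrite lexx ler01.
have := IH (doubling (doubling x)); case: (coin x) => /=; lra.
Qed.

Lemma odd_bits_rec_nd x : nondecreasing_seq (odd_bits_rec ^~ x).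
Proof.
apply/nondecreasing_seqP => n; elim: n x => [|n IH] x.
  by have /andP[] := odd_bits_rec_itv 1 x.
have E m y : odd_bits_rec m.+1 y =
  ((coin y)%:R + odd_bits_rec m (doubling (doubling y))) / 2 by [].
by have := IH (doubling (doubling x)); rewrite (E n.+1 x) (E n x); lra.
Qed.

Definition odd_bits x : R := limn (odd_bits_rec ^~ x).

Lemma odd_bits_cvg x : odd_bits_rec ^~ x @ \oo --> odd_bits x.
Proof.
apply: nondecreasing_is_cvgn; first exact: odd_bits_rec_nd.
by exists 1 => _ [n _ <-]; have /andP[] := odd_bits_rec_itv n x.
Qed.

Lemma odd_bits_itv x : 0 <= odd_bits x <= 1.
Proof.
apply/andP; split.
  apply: (limr_ge (odd_bits_cvg x)); near=> n; by have /andP[] := odd_bits_rec_itv n x.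
apply: (limr_le (odd_bits_cvg x)); near=> n; by have /andP[] := odd_bits_rec_itv n x.
Unshelve. all: by end_near. Qed.

Lemma odd_bitsE x : odd_bits x = ((coin x)%:R + odd_bits (doubling (doubling x))) / 2.
Proof.
have c1 : (fun n => odd_bits_rec n.+1 x) @ \oo --> odd_bits x.
  by have := odd_bits_cvg x; rewrite -(cvg_shiftS (odd_bits_rec ^~ x)).
apply: (cvg_unique _ c1) => //=.
apply: cvgMl; apply: cvgD; first exact: cvg_cst.
exact: odd_bits_cvg.
Qed.

Lemma measurable_odd_bits : measurable_fun setT odd_bits.
Proof.
apply: (@measurable_fun_cvg _ _ _ _ odd_bits_rec) => [n|x _]; last exact: odd_bits_cvg.
elim: n => [|n IH] /=; first exact: measurable_cst.
apply: measurable_funM => //; apply: measurable_funD.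
  rewrite (_ : (fun x => _) = (fun x => if coin x then 1 else 0)).
    by apply: measurable_fun_if => //; exact: measurable_funTS measurable_coin.
  by apply/funext => x; case: coin.
apply: measurableT_comp => //.
by apply: measurableT_comp; exact: measurable_doubling.
Qed.

Definition even_bits x : R := odd_bits (doubling x).

Lemma measurable_even_bits : measurable_fun setT even_bits.
Proof. exact: measurableT_comp measurable_odd_bits measurable_doubling. Qed.

(** The distribution function [h] and [clamp] satisfy the same self-similarity equation. At every
    point one of its two terms is trivially equal for both (0 or 1), so their distance halves with
    each application and must vanish. *)
Lemma odd_bits_cdf x : unit_prob (odd_bits @^-1` `]-oo, x]%classic) = (clamp x)%:E.
Proof.
pose h y := fine (unit_prob (odd_bits @^-1` `]-oo, y]%classic)).
have mO y : measurable (odd_bits @^-1` `]-oo, y]%classic).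
  by apply: (measurable_preimage measurable_odd_bits); exact: measurable_itv.
have hE y : unit_prob (odd_bits @^-1` `]-oo, y]%classic) = (h y)%:E.
  by rewrite fineK//; exact: fin_num_measure.
have h01 y : 0 <= h y <= 1.
  by rewrite -!lee_fin -hE measure_ge0 probability_le1.
have h0 y : y < 0 -> h y = 0.
  move=> y0; rewrite /h (_ : _ @^-1` _ = set0) ?measure0//.
  apply/seteqP; split => z //=; rewrite in_itv/=.
  by have /andP[? _] := odd_bits_itv z; lra.
have h1 y : 1 <= y -> h y = 1.
  move=> y0; rewrite /h (_ : _ @^-1` _ = setT) ?probability_setT//.
  apply/seteqP; split => z //=; rewrite in_itv/= => _.
  by have /andP[_ ?] := odd_bits_itv z; lra.
have hrec y : h y = 2^-1 * (h (2 * y) + h (2 * y - 1)).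
  apply: EFin_inj; rewrite -hE.
  have -> : odd_bits @^-1` `]-oo, y]%classic =
      ([set z | coin z = false] `&` doubling @^-1` (even_bits @^-1` `]-oo, 2 * y]%classic)) `|`
      ([set z | coin z = true] `&` doubling @^-1` (even_bits @^-1` `]-oo, 2 * y - 1]%classic)).
    apply/seteqP; split => z /=; rewrite !in_itv/= odd_bitsE /even_bits.
      by case: (coin z) => /=; [right|left]; split => //; lra.
    by case => -[-> ] /=; lra.
  have mE y' : measurable (even_bits @^-1` `]-oo, y']%classic).
    by apply: (measurable_preimage measurable_even_bits); exact: measurable_itv.
  have mDE y' := measurable_preimage measurable_doubling (mE y').
  have mc := measurable_coin_eq.
  rewrite measureU; first last.
  - by apply/seteqP; split => z //= -[[-> _] [? _]].
  - exact: measurableI.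
  - exact: measurableI.
  rewrite [X in (X + _)%E]unit_law_coin// [X in (_ + X)%E]unit_law_coin//.
  have lawE y' : unit_prob (even_bits @^-1` `]-oo, y']%classic) = (h y')%:E.
    by rewrite -hE; exact: (unit_law_doubling _ (mO y')).
  by rewrite !lawE -!EFinM -EFinD mulrDr.
suff H n y : `|h y - clamp y| <= 2^-1 ^+ n.
  rewrite hE; congr EFin; apply/eqP; rewrite -subr_eq0 -normr_le0.
  rewrite leNgt; apply/negP => p.
  have [n _ /(_ n (leqnn n))] := near_infty_natSinv_expn_lt (PosNum p).
  by rewrite div1r -exprVn /= ltNge H.
elim: n y => [|n IH] y.
  by have := h01 y; have := clamp_itv y; rewrite expr0 ler_norml; lra.
rewrite hrec clamp_halve exprS.
have := IH (2 * y); have := IH (2 * y - 1).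
have [y1|y1] := leP 1 (2 * y).
  by rewrite [h (2 * y)]h1// (clamp_ge1 (2 * y))// !ler_norml; lra.
rewrite [h (2 * y - 1)]h0 ?(clamp_le0 (2 * y - 1)); [|lra|lra].
by rewrite !ler_norml; lra.
Qed.

End unit_interval.

(** * Independent sequences and sampling *)

Section iid_uniforms.
Context {R : realType}.
Implicit Types (x : R) (A B : set R).
Local Notation P := (@unit_prob R).

Lemma odd_bits_law B : measurable B -> P (odd_bits @^-1` B) = P B.
Proof.
move=> mB; rewrite -[LHS](congr1 P (setTI _)) -[RHS]mul1e.
apply: law_ext => //; [exact: measurable_odd_bits|exact: probability_setT|].
by move=> x; rewrite setTI odd_bits_cdf mul1e unit_law_cdf.
Qed.

(** Deleting the first digit turns even positions into odd ones, so the recursion for the joint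
    distribution function swaps its arguments. The contraction is otherwise that of
    [odd_bits_cdf]. *)
Lemma bits_cdf x y : P (odd_bits @^-1` `]-oo, x]%classic `&`
  even_bits @^-1` `]-oo, y]%classic) = (clamp x * clamp y)%:E.
Proof.
have mO (z : R) : measurable (odd_bits @^-1` `]-oo, z]%classic).
  by apply: (measurable_preimage measurable_odd_bits); exact: measurable_itv.
have mE (z : R) : measurable (even_bits @^-1` `]-oo, z]%classic).
  by apply: (measurable_preimage measurable_even_bits); exact: measurable_itv.
pose C (u v : R) := odd_bits @^-1` `]-oo, u]%classic `&` even_bits @^-1` `]-oo, v]%classic.
have mC u v : measurable (C u v) by exact: measurableI.
pose H u v := fine (P (C u v)).
have HE u v : P (C u v) = (H u v)%:E by rewrite fineK//; exact: fin_num_measure.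
have H01 u v : 0 <= H u v <= 1.
  by rewrite -!lee_fin -HE measure_ge0 probability_le1.
have H0 u v : v < 0 -> H u v = 0.
  move=> v0; rewrite /H (_ : C u v = set0) ?measure0//.
  apply/seteqP; split => z //= -[_] /=; rewrite in_itv/=.
  by have /andP[? _] := odd_bits_itv (doubling z); rewrite /even_bits; lra.
have H1 u v : 1 <= v -> H u v = clamp u.
  move=> v1; apply: EFin_inj; rewrite -HE -odd_bits_cdf; congr (P _).
  apply/seteqP; split => z; first by case.
  move=> uz; split => //=; rewrite in_itv/=.
  by have /andP[_ ?] := odd_bits_itv (doubling z); rewrite /even_bits; lra.
have Hrec u v : H u v = 2^-1 * (H v (2 * u) + H v (2 * u - 1)).
  apply: EFin_inj; rewrite -HE.
  have -> : C u v = ([set z | coin z = false] `&` doubling @^-1` C v (2 * u)) `|`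
      ([set z | coin z = true] `&` doubling @^-1` C v (2 * u - 1)).
    apply/seteqP; split => z; rewrite /C /= !in_itv/= (odd_bitsE z) /even_bits.
      by case: (coin z) => /= -[? ?]; [right|left]; split => //; split; lra.
    by case => -[-> [? ?]] /=; split; lra.
  have mDC u' v' := measurable_preimage measurable_doubling (mC u' v').
  have mc := measurable_coin_eq.
  rewrite measureU; first last.
  - by apply/seteqP; split => z //= -[[-> _] [? _]].
  - by apply: measurableI; [exact: mc|exact: mDC].
  - by apply: measurableI; [exact: mc|exact: mDC].
  rewrite [X in (X + _)%E]unit_law_coin// [X in (_ + X)%E]unit_law_coin//.
  by rewrite !HE -!EFinM -EFinD mulrDr.
suff K n u v : `|H u v - clamp u * clamp v| <= 2^-1 ^+ n.
  rewrite -/(C x y) HE; congr EFin; apply/eqP; rewrite -subr_eq0 -normr_le0.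
  rewrite leNgt; apply/negP => p.
  have [n _ /(_ n (leqnn n))] := near_infty_natSinv_expn_lt (PosNum p).
  by rewrite div1r -exprVn /= ltNge K.
have c01 := @clamp_itv R.
elim: n u v => [|n IH] u v.
  have := H01 u v; have /andP[u0 u1] := c01 u; have /andP[v0 v1] := c01 v.
  have : 0 <= clamp u * clamp v <= 1 by rewrite mulr_ge0// mulr_ile1.
  by rewrite expr0 ler_norml; lra.
rewrite Hrec clamp_halve exprS.
have := IH v (2 * u); have := IH v (2 * u - 1).
have [y1|y1] := leP 1 (2 * u).
  rewrite (clamp_ge1 (2 * u))//.
  rewrite [H v (2 * u)]H1// !ler_norml.
  move: (clamp _) (clamp _) (H _ _) (2^-1 ^+ n) => a b c e.
  have -> : 2^-1 * (1 + a) * b = 2^-1 * (b + b * a) by ring.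
  by lra.
rewrite (clamp_le0 (2 * u - 1)); last lra.
rewrite [H v (2 * u - 1)]H0 ?mulr0; last lra.
rewrite !ler_norml.
move: (clamp _) (clamp _) (H _ _) (2^-1 ^+ n) => a b c e.
have -> : 2^-1 * (a + 0) * b = 2^-1 * (b * a) by ring.
by lra.
Qed.

(** Two passes of [law_ext]: one extends the even event from half-lines to Borel sets, the other
    does the same for the odd event. *)
Lemma bits_indep A B : measurable A -> measurable B ->
  P (odd_bits @^-1` A `&` even_bits @^-1` B) = (P A * P B)%E.
Proof.
move=> mA mB.
have mOA := measurable_preimage measurable_odd_bits mA.
have mE (y : R) : measurable (even_bits @^-1` `]-oo, y]%classic).
  by apply: (measurable_preimage measurable_even_bits); exact: measurable_itv.
have PE (y : R) : P (even_bits @^-1` `]-oo, y]%classic) = (clamp y)%:E.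
  rewrite -unit_law_cdf -(odd_bits_law `]-oo, y]%classic); last exact: measurable_itv.
  apply: (unit_law_doubling (odd_bits @^-1` `]-oo, y]%classic)).
  by apply: (measurable_preimage measurable_odd_bits); exact: measurable_itv.
have c0 y : 0 <= clamp y :> R by have /andP[] := clamp_itv y.
have PA : P A = (fine (P A))%:E by rewrite fineK//; exact: fin_num_measure.
rewrite [in RHS]PA; apply: law_ext => //; first exact: measurable_even_bits.
- exact: fine_ge0.
- by rewrite -PA; exact: odd_bits_law.
move=> y; rewrite setIC -PA unit_law_cdf muleC.
apply: law_ext => //; first exact: measurable_odd_bits.
by move=> x; rewrite setIC bits_cdf unit_law_cdf -EFinM mulrC.
Qed.

Lemma even_bits_law B : measurable B -> P (even_bits @^-1` B) = P B.
Proof.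
move=> mB; have := bits_indep setT B measurableT mB.
by rewrite preimage_setT setTI probability_setT mul1e.
Qed.

(* [bits_indep] splits one uniform variable into an independent uniform pair;
   iterating on the second component gives an i.i.d. sequence. *)
Definition unif (n : nat) x : R := odd_bits (iter n even_bits x).

Lemma measurable_iter_even_bits n : measurable_fun setT (iter n even_bits : R -> R).
Proof.
elim: n => [|n IH] /=; first exact: measurable_id.
exact: measurableT_comp measurable_even_bits IH.
Qed.

Lemma measurable_unif n : measurable_fun setT (unif n).
Proof. exact: measurableT_comp measurable_odd_bits (measurable_iter_even_bits n). Qed.

Lemma unif_prefix n (A : nat -> set R) B : (forall i, measurable (A i)) -> measurable B ->
  P (\big[setI/setT]_(i < n) (unif i @^-1` A i) `&` iter n even_bits @^-1` B) =
  (\prod_(i < n) P (A i) * P B)%E.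
Proof.
move=> mA; elim: n B => [|n IH] B mB; first by rewrite !big_ord0 setTI mul1e.
rewrite !big_ord_recr/= -setIA -muleA -bits_indep//.
rewrite -IH; first by congr (P _).
by apply: measurableI; [apply: (measurable_preimage measurable_odd_bits)|
  apply: (measurable_preimage measurable_even_bits)].
Qed.

Lemma big_uniq_ord (Z : Type) (idx : Z) (op : Monoid.com_law idx) (L : seq nat)
    (G : nat -> Z) : uniq L ->
  \big[op/idx]_(i <- L) G i =
  \big[op/idx]_(i < (\max_(i <- L) i).+1) (if (i : nat) \in L then G i else idx).
Proof.
move=> uL; set n := (\max_(i <- L) i).+1.
have pL : perm_eq [seq i <- index_iota 0 n | i \in L] L.
  apply: uniq_perm => //; first by rewrite filter_uniq// iota_uniq.
  move=> i; rewrite mem_filter mem_index_iota/= /n ltnS.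
  by have [iL|//] := boolP (i \in L); rewrite (big_rem _ iL)/= leq_maxl.
by rewrite -(perm_big _ pL) big_filter big_mkcond big_mkord.
Qed.

(** A finite set of indices is completed to an initial segment by trivial events, so that
    [unif_prefix] applies. *)
Lemma unif_indep_nat (L : seq nat) (A : nat -> set R) :
  (forall i, measurable (A i)) -> uniq L ->
  P (\big[setI/setT]_(i <- L) (unif i @^-1` A i)) = (\prod_(i <- L) P (A i))%E.
Proof.
move=> mA uL; pose n := (\max_(i <- L) i).+1.
pose D i := if i \in L then A i else setT.
have mD i : measurable (D i) by rewrite /D; case: ifP.
have := @unif_prefix n D setT mD measurableT.
rewrite preimage_setT setIT probability_setT mule1 => H.
rewrite big_uniq_ord// [RHS]big_uniq_ord// -/n.
transitivity (P (\big[setI/setT]_(i < n) (unif i @^-1` D i))).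
  by congr (P _); apply: eq_bigr => i _; rewrite /D; case: ifP.
rewrite H; apply: eq_bigr => i _; rewrite /D; case: ifP => // _.
by rewrite probability_setT.
Qed.

Lemma unif_mutually_independent (I : countType) (F : I -> set (set R)) :
  (forall i A, F i A -> exists2 B, measurable B & A = unif (pickle i) @^-1` B) ->
  mutually_independent P F.
Proof.
move=> FU J A uJ FA.
have /choice[B HB] : forall i, exists B, i \in J ->
    measurable B /\ A i = unif (pickle i) @^-1` B.
  move=> i; have [iJ|_] := boolP (i \in J); last by exists setT.
  by have [B mB ->] := FU _ _ (FA _ iJ); exists B.
(* Events are transported along [pickle]; numbers that code no index of [J] receive the trivial
   event. *)
pose C n := if @pickle_inv I n is Some i then if i \in J then B i else setT else setT.
have CE i : i \in J -> C (pickle i) = B i by move=> iJ; rewrite /C pickleK_inv iJ.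
have mC n : measurable (C n).
  rewrite /C; case: pickle_inv => // i; case: ifP => // iJ.
  by have [] := HB i iJ.
have PE i : i \in J -> P (A i) = P (C (pickle i)).
  move=> iJ; have [mB ->] := HB i iJ; rewrite (CE i iJ).
  have := @unif_indep_nat [:: pickle i] (fun=> B i) _ _.
  by rewrite !big_seq1; apply.
have := @unif_indep_nat (map pickle J) C mC.
rewrite map_inj_uniq; last exact: (pcan_inj pickleK).
move=> /(_ uJ); rewrite !big_map => H.
rewrite -(eq_big_seq _ PE) in H.
rewrite -H; congr (P _); apply: eq_big_seq => i iJ.
by have [_ ->] := HB i iJ; rewrite (CE i iJ).
Qed.

End iid_uniforms.

Section sampling.
Context {R : realType}.
Local Notation P := (@unit_prob R).

Lemma probability_setI1 {d} {T : measurableType d} (Q : probability T R) (A B : set T) :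
  measurable A -> measurable B -> Q A = 1%E -> Q (B `&` A) = Q B.
Proof.
move=> mA mB QA; have QAC : Q (~` A) = 0%E by rewrite probability_setC// QA subee.
rewrite -[in RHS](setIT B) -(setUv A) setIUr measureU//; first last.
- by apply/seteqP; split => x //= -[[_ ?] [_]].
- by apply: measurableI => //; exact: measurableC.
- exact: measurableI.
rewrite [X in (_ + X)%E](_ : _ = 0%E) ?adde0//.
by apply: (subset_measure0 _ (measurableC mA)) => //; apply: measurableI => //; exact: measurableC.
Qed.

Lemma quantile_transform (mu : probability R R) :
  exists2 Q : R -> R, measurable_fun setT Q &
    forall B, measurable B -> P (Q @^-1` B) = mu B.
Proof.
have mI (i : interval R) : measurable [set` i] by exact: measurable_itv.
pose X : {mfun R >-> R} := HB.pack (idfun : R -> R) (isMeasurableFun.Build _ _ _ _ (idfun : R -> R) (@measurable_id _ _ setT)).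
pose F x := fine (cdf (X : {RV mu >-> R}) x).
have FE x : mu `]-oo, x]%classic = (F x)%:E by rewrite fineK//; exact: fin_num_measure.
have F01 x : 0 <= F x <= 1 by rewrite -!lee_fin -FE measure_ge0 probability_le1.
have F_nd x y : x <= y -> F x <= F y.
  by move=> xy; rewrite fine_le ?fin_num_measure// cdf_nondecreasing.
have Fy u : u < 1 -> exists x, u < F x.
  have : F @ +oo --> (1 : R) by exact/fine_cvg/cvg_cdfy1.
  by move=> /cvgr_gt H /H /filter_ex.
have FNy u : 0 < u -> exists x, F x < u.
  have : F @ -oo --> (0 : R) by exact/fine_cvg/cvg_cdfNy0.
  by move=> /cvgr_lt H /H /filter_ex.
have Frc x u : F x < u -> exists2 y, x < y & F y < u.
  have : F @ x^'+ --> F x.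
    apply: fine_cvg; rewrite fineK; last exact: fin_num_measure.
    exact: cdf_right_continuous.
  move=> /cvgr_lt H /H {}H.
  have [y [? ?]] : exists y, F y < u /\ x < y.
    apply: (@filter_ex _ x^'+); apply: filterI => //.
    exact: nbhs_right_gt.
  by exists y.
clearbody F.
(* The generalized inverse of [F]: right continuity gives [x < Q u] exactly when [F x < u]. The
   value 0 is assigned only outside the open unit interval, a null set. *)
pose Q u := if 0 < u < 1 then sup [set x | F x < u] else 0.
have QP u x : 0 < u < 1 -> (x < Q u) = (F x < u).
  move=> u01; have /andP[u0 u1] := u01; rewrite /Q u01.
  have [x0 Fx0] := FNy _ u0; have [x1 Fx1] := Fy _ u1.
  have hs : has_sup [set x | F x < u].
    split; first by exists x0.
    exists x1 => y /= Fyu; rewrite leNgt; apply/negP => /ltW/F_nd.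
    by rewrite leNgt (lt_trans Fyu).
  apply/idP/idP => [|/Frc[y xy Fyu]].
    rewrite -subr_gt0 => /sup_adherent/(_ hs)[y /= Fyu]; rewrite subKr => xy.
    exact: le_lt_trans (F_nd _ _ (ltW xy)) Fyu.
  by rewrite (lt_le_trans xy)//; apply: (ub_le_sup (proj2 hs)).
have Qpre x : Q @^-1` `]x, +oo[%classic = (`]0, 1[%classic `&` `]F x, +oo[%classic) `|`
    ((~` `]0, 1[%classic) `&` [set _ | x < 0]).
  apply/seteqP; split => u /=; rewrite !in_itv/= !andbT.
    have [u01|u01] := boolP (0 < u < 1); first by rewrite QP//; left.
    by rewrite /Q (negbTE u01); right; split => //; exact/negP.
  case=> [[u01 Fu]|[/negP u01 x0]]; first by rewrite QP.
  by rewrite /Q (negbTE u01).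
have mQ : measurable_fun setT Q.
  apply: (measurability (@RGenOInfty.G R)) => [|/= _ [_] [x ->] <-].
    exact: RGenOInfty.measurableE.
  rewrite setTI Qpre; apply: measurableU; apply: measurableI => //.
    exact: measurableC.
  by have [x0|x0] := boolP (x < 0);
    [rewrite (_ : mkset _ = setT)//|rewrite (_ : mkset _ = set0)//];
    apply/seteqP; split => // ? /=; rewrite ?(negbTE x0).
exists Q => // B mB.
rewrite -[LHS](congr1 P (setTI _)) -[RHS]mul1e.
apply: law_ext => //; first exact: probability_setT.
move=> x; rewrite setTI mul1e FE.
have m01 : P `]0, 1[%classic = 1%E by rewrite unit_law_itv// subr0.
have mQx : measurable (Q @^-1` `]-oo, x]%classic) by exact: measurable_preimage.
rewrite -(probability_setI1 P _ _ (mI `]0, 1[) mQx m01).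
rewrite (_ : _ `&` _ = `]-oo, F x]%classic `&` `]0, 1[%classic); last first.
  apply/seteqP; split => u /=; rewrite !in_itv/= => -[H u01]; split => //.
    by rewrite leNgt -QP// -leNgt.
  by rewrite leNgt QP// -leNgt.
by rewrite (probability_setI1 P _ _ (mI `]0, 1[) (mI `]-oo, F x]) m01) unit_law_cdf clamp_id.
Qed.

Lemma discrete_sampling (q : nat -> R) : (forall k, 0 <= q k) ->
  (\sum_(0 <= k <oo) (q k)%:E = 1%:E)%E ->
  exists z : R -> nat, (forall k, measurable (z @^-1` [set k])) /\
    forall k, P (z @^-1` [set k]) = (q k)%:E.
Proof.
move=> q0 q1.
have mI (i : interval R) : measurable [set` i] by exact: measurable_itv.
pose S n := \sum_(0 <= k < n) q k.
have SS n : S n.+1 = S n + q n by rewrite /S big_nat_recr.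
have S_nd m n : (m <= n)%N -> S m <= S n.
  move=> /subnK <-; elim: (n - m)%N => //= k IH; rewrite addSn SS.
  by rewrite (le_trans IH)// lerDl.
have S0 n : 0 <= S n by rewrite -(_ : S 0%N = 0) ?S_nd// /S big_geq.
have S1 n : S n <= 1.
  rewrite -lee_fin -q1 /S -sumEFin.
  by apply: nneseries_lim_ge => k _; rewrite lee_fin.
have Sz : S 0%N = 0 by rewrite /S big_geq.
have Scvg : S @ \oo --> (1 : R).
  have : (fun n => (S n)%:E) @ \oo --> 1%:E.
    rewrite -q1; under eq_fun do rewrite /S -sumEFin.
    by apply: is_cvg_nneseries => k _ _; rewrite lee_fin.
  exact: fine_cvg.
clearbody S.
pose J m := `[S m, S m.+1[%classic.
have PJ m : P (J m) = (q m)%:E by rewrite unit_law_itv// SS ?lerDl// addrAC subrr add0r.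
have Juniq m n (u : R) : J m u -> J n u -> m = n.
  rewrite /J /= !in_itv/= => /andP[a b] /andP[c d].
  have [mn|nm|//] := ltngtP m n.
    by have := lt_le_trans b (le_trans (S_nd _ _ mn) c); rewrite ltxx.
  by have := lt_le_trans d (le_trans (S_nd _ _ nm) a); rewrite ltxx.
(* Inversion on the partition of [0, 1[ into the intervals [J m]. Points in none of them are sent to
   0, so the preimage of 0 is larger than [J 0] and its probability needs an argument of its own. *)
pose z (u : R) := xget 0%N [set m | J m u].
have zJ m u : J m u -> z u = m.
  move=> Jmu; rewrite /z; case: xgetP => [k -> /= Jk|/(_ m)//].
  exact: Juniq Jk Jmu.
have Jz u : z u <> 0%N -> J (z u) u.
  by rewrite /z; case: xgetP => [k ->|].
have zE m : (0 < m)%N -> z @^-1` [set m] = J m.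
  move=> m0; apply/seteqP; split => u /=; last exact: zJ.
  by move=> zu; rewrite -zu; apply: Jz; rewrite zu => m00; rewrite m00 in m0.
have z0 : z @^-1` [set 0%N] = ~` (\bigcup_m (J m.+1)).
  apply/seteqP; split => u /=.
    by move=> zu [m _ /zJ]; rewrite zu.
  move=> H; apply: contrapT => zu; apply: H; exists (z u).-1 => //.
  by rewrite prednK ?lt0n; [exact: Jz|exact/eqP].
have mz k : measurable (z @^-1` [set k]).
  case: k => [|k]; last by rewrite zE//; exact: mI.
  by rewrite z0; apply: measurableC; apply: bigcupT_measurable => i; exact: mI.
exists z; split => // -[|k]; last by rewrite zE.
apply/eqP; rewrite eq_le; apply/andP; split; last first.
  rewrite -PJ; apply: le_measure; rewrite ?inE//; first exact: mI.
  exact: zJ.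
(* The preimage of 0 misses [J 1], ..., [J n]; letting [n] grow leaves exactly [q 0]. *)
have H n : (P (z @^-1` [set 0%N]) <= (q 0%N)%:E + 1 - (S n.+1)%:E)%E.
  have Sle : S 1%N <= S n.+1 by exact: S_nd.
  have -> : ((q 0%N)%:E + 1 - (S n.+1)%:E = 1 - P `[S 1%N, S n.+1[%classic)%E.
    rewrite unit_law_itv// -!EFinD; congr EFin; have := SS 0%N; rewrite Sz; lra.
  rewrite -probability_setC; last exact: mI.
  apply: le_measure; rewrite ?inE//; first by apply: measurableC; exact: mI.
  rewrite z0; apply: subsetC => u /=; rewrite in_itv/= => /andP[u1].
  elim: n {Sle} => [|n IH] un; first by move: un; rewrite ltNge u1.
  have [/IH//|un'] := ltP u (S n.+1).
  by exists n => //; rewrite /J /= in_itv/= un' un.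
apply/lee_addgt0Pr => e e0.
move/cvgr_gt : Scvg => /(_ (1 - e)); have e1 : 1 - e < 1 by lra.
move=> /(_ e1)[n _ /(_ n.+1 (leqnSn _)) Sn].
by apply: (le_trans (H n)); rewrite -!EFinD lee_fin; move: Sn => /=; lra.
Qed.

End sampling.

(** * Dyadic boxes and graph distance *)

Section torus_geometry.
Context {R : realType}.
Implicit Types (y z r : R) (n j k m a b : nat).

Lemma circ_dist_itv n (t : R) : (0 < n)%N -> 0 <= circ_dist n t <= `|t|.
Proof.
move=> n0; rewrite /circ_dist; set x := t / n%:R.
have n0R : 0 < n%:R :> R by rewrite ltr0n.
have tE : t = n%:R * x by rewrite mulrC divfK// gt_eqF.
have := floor_itv x; set f := Num.floor x; move=> /andP[fl fg].
have f1 : (f + 1)%:~R = f%:~R + 1 :> R by rewrite intrD.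
rewrite {}f1 in fg; set u := x - f%:~R.
have u01 : 0 <= u < 1 by rewrite /u; lra.
apply/andP; split; first by rewrite mulr_ge0 ?ler0n// le_min; lra.
(* With t/n = f + u, nonnegative f gives |t|/n >= u, and f <= -1 gives |t|/n >= 1 - u. *)
have [f0|f0] := leP 0 f.
  have f0R : 0 <= f%:~R :> R by rewrite ler0z.
  rewrite tE normrM (gtr0_norm n0R) ger0_norm; last by rewrite /u in u01; lra.
  by rewrite (ler_pM2l n0R) ge_min; apply/orP; left; rewrite /u; lra.
have f0R : f%:~R <= -1 :> R by rewrite -[-1]/((-1)%:~R) ler_int; lia.
rewrite tE normrM (gtr0_norm n0R) ler0_norm; last by rewrite /u in u01; lra.
by rewrite (ler_pM2l n0R) ge_min; apply/orP; right; rewrite /u; lra.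
Qed.

Lemma torus_dist_le {dim : nat} n (x y : 'I_dim -> R) r : (0 < n)%N -> 0 <= r ->
  (forall c, `|x c - y c| <= r) -> torus_dist n x y <= Num.sqrt dim%:R * r.
Proof.
move=> n0 r0 xy; rewrite /torus_dist -{1}(ger0_norm r0) -sqrtr_sqr -sqrtrM ?ler0n// ler_wsqrtr//.
have -> : dim%:R * r ^+ 2 = \sum_(c < dim) r ^+ 2 :> R.
  by rewrite sumr_const card_ord mulr_natl.
apply: ler_sum => c _; have /andP[d0 d1] := @circ_dist_itv n (x c - y c) n0.
by rewrite ler_sqr ?nnegrE// (le_trans d1).
Qed.

Definition in_dyad j a y : bool := a%:R <= 2 ^+ j * y < a.+1%:R.

Lemma in_dyad_anc j m a y : in_dyad (j + m) a y -> in_dyad j (a %/ 2 ^ m) y.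
Proof.
rewrite /in_dyad exprD => /andP[ay ya]; apply/andP.
have p0 : 0 < 2 ^+ m :> R by rewrite exprn_gt0.
have pE : 2 ^+ m = (2 ^ m)%N%:R :> R by rewrite natrX.
split.
  rewrite -(ler_pM2r p0) mulrAC (le_trans _ ay)// pE -natrM ler_nat.
  exact: leq_trunc_div.
rewrite -(ltr_pM2r p0) mulrAC (lt_le_trans ya)// pE -natrM ler_nat.
by rewrite ltn_ceil// expn_gt0.
Qed.

Lemma in_dyad_inj j a b y : in_dyad j a y -> in_dyad j b y -> a = b.
Proof.
move=> /andP[ay ya] /andP[by_ yb].
have := le_lt_trans ay yb; have := le_lt_trans by_ ya.
by rewrite !ltr_nat; lia.
Qed.

Lemma in_dyad_dist j a b y z : in_dyad j a y -> in_dyad j b z ->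
  (a <= b.+1)%N -> (b <= a.+1)%N -> `|y - z| <= 2 / 2 ^+ j.
Proof.
move=> /andP[ay ya] /andP[bz zb] ab ba.
have p0 : 0 < 2 ^+ j :> R by rewrite exprn_gt0.
rewrite ler_pdivlMr// -[X in _ * X]gtr0_norm// -normrM.
have : a%:R <= b%:R + 1 :> R by rewrite natr1 ler_nat.
have : b%:R <= a%:R + 1 :> R by rewrite natr1 ler_nat.
rewrite -natr1 in ya; rewrite -natr1 in zb.
by rewrite ler_norml mulrBl ![_ * 2 ^+ j]mulrC; lra.
Qed.

Definition dyad_cell k y : nat := Num.truncn (2 ^+ k * y).

Lemma in_dyad_cell k y : 0 <= y -> in_dyad k (dyad_cell k y) y.
Proof.
move=> y0; have p0 : 0 <= 2 ^+ k * y by rewrite mulr_ge0// exprn_ge0.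
by have := truncn_itv p0.
Qed.

Lemma dyad_cell_lt k y : 0 <= y < 1 -> (dyad_cell k y < 2 ^ k)%N.
Proof.
move=> /andP[y0 y1]; have /andP[H _] := in_dyad_cell k y y0.
rewrite -(ltr_nat R) (le_lt_trans H)// natrX gtr_pMr// exprn_gt0//.
Qed.

(** The index of the other child of the same dyadic parent. *)
Definition sibling a : nat := if odd a then a.-1 else a.+1.

Lemma sibling_half a : (sibling a %/ 2 = a %/ 2)%N.
Proof. by rewrite /sibling; case: ifP => ?; lia. Qed.

Lemma sibling_neq a : sibling a != a.
Proof. by rewrite /sibling; case: ifP => ?; lia. Qed.

Definition ancestor k j a : nat := a %/ 2 ^ (k - j).

Lemma ancestorE k j m a : (j + m <= k)%N -> ancestor k j a = (ancestor k (j + m) a %/ 2 ^ m)%N.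
Proof.
by move=> jk; rewrite /ancestor -divnMA -expnD; congr (_ %/ 2 ^ _)%N; lia.
Qed.

Lemma ancestor_leS k j a b : (a <= b.+1)%N -> (ancestor k j a <= (ancestor k j b).+1)%N.
Proof.
move=> ab; rewrite /ancestor; have p0 : (0 < 2 ^ (k - j))%N by rewrite expn_gt0.
rewrite -ltnS ltn_divLR// (leq_ltn_trans ab)//.
by have := ltn_ceil b p0; rewrite !mulSn; lia.
Qed.

Context {dim : nat}.
Implicit Types (p q : mpoint R dim) (c e : 'I_dim -> nat).

Definition unit_coord n y : R := y / n%:R + 2^-1.

Definition good_vertex_level j (t : 'I_dim) : nat := if t == 0%N :> nat then j.+1 else j.
Definition good_vertex_index k c j (t : 'I_dim) : nat :=
  if t == 0%N :> nat then sibling (ancestor k j.+1 (c t)) else ancestor k j (c t).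
(** Coordinates of points in two touching level-[j] boxes differ by at most 2n/2^j; the factor
    sqrt(dim) passes to Euclidean distance. *)
Definition good_vertex_radius n j : R := Num.sqrt dim%:R * (2 * n%:R / 2 ^+ j).

(* Only the half of the level-[j] ancestor box of [c] that lies, in direction [0],
   away from the level-[j.+1] ancestor is used, so that the regions of distinct
   [j] are disjoint. *)
Definition good_vertex n k c j p : bool :=
  [forall t, in_dyad (good_vertex_level j t) (good_vertex_index k c j t) (unit_coord n (p.1 t))] &&
  (good_vertex_radius n j < p.2).

Lemma good_vertex_ancestor n k c j p : (j < k)%N -> good_vertex n k c j p ->
  forall t, in_dyad j (ancestor k j (c t)) (unit_coord n (p.1 t)).
Proof.
move=> jk /andP[/forallP H _] t; have := H t.
rewrite /good_vertex_level /good_vertex_index; case: ifP => // _ /=.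
rewrite -addn1 => /in_dyad_anc; rewrite expn1 sibling_half.
by rewrite -(ancestorE k j 1)// addn1.
Qed.

(** Indices that differ by at most one keep this property under taking ancestors, so [p] and [q] lie
    in equal or touching boxes of level [j]. *)
Lemma good_vertex_near n k c e j p q : (0 < n)%N -> (j < k)%N -> good_vertex n k c j p ->
  (forall t, in_dyad j (ancestor k j (e t)) (unit_coord n (q.1 t))) ->
  (forall t, (c t <= (e t).+1)%N /\ (e t <= (c t).+1)%N) ->
  torus_dist n p.1 q.1 <= p.2.
Proof.
move=> n0 jk gp qe ce; have /andP[_ /ltW] := gp; apply: le_trans.
have n0R : 0 < n%:R :> R by rewrite ltr0n.
have r0 : 0 <= 2 * n%:R / 2 ^+ j :> R by rewrite divr_ge0 ?mulr_ge0 ?exprn_ge0.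
apply: torus_dist_le => // t.
have [ce1 ce2] := ce t.
have := in_dyad_dist _ _ _ _ _ (good_vertex_ancestor _ _ _ _ _ jk gp t) (qe t)
  (ancestor_leS _ _ _ _ ce1) (ancestor_leS _ _ _ _ ce2).
have -> : unit_coord n (p.1 t) - unit_coord n (q.1 t) = (p.1 t - q.1 t) / n%:R.
  by rewrite /unit_coord opprD addrACA subrr addr0 mulrBl.
rewrite normrM [`|_^-1|]gtr0_norm ?invr_gt0// ler_pdivrMr//.
by move=> H; apply: (le_trans H); rewrite mulrAC.
Qed.

Lemma in_dyad_ancestor k j l a y : (j <= l)%N -> (l <= k)%N ->
  in_dyad l (ancestor k l a) y -> in_dyad j (ancestor k j a) y.
Proof.
move=> jl lk; rewrite (ancestorE k j (l - j)) subnKC// => H.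
by apply: in_dyad_anc; rewrite subnKC.
Qed.

Lemma path_map_iota (T : Type) (r : rel T) (f : nat -> T) a m :
  (forall s, r (f s) (f s.+1)) -> path r (f a) (map f (iota a.+1 m)).
Proof. by move=> rf; elim: m a => //= m IH a; rewrite rf IH. Qed.

(** Every coordinate moves by one per step and then waits at its target. Consecutive cells touch,
    possibly diagonally, so [2 ^ k] steps join any two cells without using the periodicity of the
    torus. *)
Definition grid_walk c e s (t : 'I_dim) : nat :=
  if (c t <= e t)%N then minn (c t + s) (e t) else maxn (c t - s) (e t).

(* Cells that touch have adjacent good vertices, since the good vertex of lower
   level reaches all the neighbours of its own box. *)
Lemma covered_diam_le n k (X : seq (mpoint R dim)) : (0 < n)%N ->
  (forall i : 'I_(size X), forall t, 0 <= unit_coord n ((nth ((fun=> 0), 0) X i).1 t) < 1) ->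
  (forall c, (forall t, (c t < 2 ^ k)%N) ->
     exists (i : 'I_(size X)) j, (j < k)%N /\ good_vertex n k c j (nth ((fun=> 0), 0) X i)) ->
  diam_le n X (2 + 2 ^ k).
Proof.
move=> n0 inX cov u w.
pose pt i := nth ((fun=> 0), 0) X i : mpoint R dim.
have /choice[v Hv] : forall c, exists i : 'I_(size X), (forall t, (c t < 2 ^ k)%N) ->
    exists j, (j < k)%N /\ good_vertex n k c j (pt i).
  move=> c; have [H|H] := pselect (forall t, (c t < 2 ^ k)%N); last by exists u.
  by have [i [j ?]] := cov c H; exists i => _; exists j.
pose cell (i : 'I_(size X)) (t : 'I_dim) := dyad_cell k (unit_coord n ((pt i).1 t)).
have cell_lt i t : (cell i t < 2 ^ k)%N by apply: dyad_cell_lt; exact: inX.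
have cell_in i t : in_dyad k (ancestor k k (cell i t)) (unit_coord n ((pt i).1 t)).
  rewrite /ancestor subnn expn0 divn1; apply: in_dyad_cell.
  by have /andP[] := inX i t.
have vcell i : gadj n X i (v (cell i)) /\ gadj n X (v (cell i)) i.
  have [j [jk g]] := Hv _ (cell_lt i).
  have H : torus_dist n (pt (v (cell i))).1 (pt i).1 <= (pt (v (cell i))).2.
    apply: (good_vertex_near _ _ _ (cell i) _ _ _ n0 jk g) => // t.
    by apply: (in_dyad_ancestor k j k) => //; exact: ltnW.
  by rewrite /gadj -!/(pt _) H orbT.
(* The vertices [v c] and [v e] may coincide: the positive radius of a good vertex makes it adjacent
   to itself, so a waiting walk is still a path. *)
have vv c e : (forall t, (c t < 2 ^ k)%N) -> (forall t, (e t < 2 ^ k)%N) ->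
    (forall t, (c t <= (e t).+1)%N /\ (e t <= (c t).+1)%N) -> gadj n X (v c) (v e).
  move=> ck ek ce; have [j [jk gc]] := Hv _ ck; have [l [lk ge]] := Hv _ ek.
  rewrite /gadj -!/(pt _); apply/orP; have [jl|lj] := leqP j l.
    left; apply: (good_vertex_near _ _ _ e _ _ _ n0 jk gc) => // t.
    apply: (in_dyad_ancestor k j l) => //; first exact: ltnW.
    exact: (good_vertex_ancestor _ _ _ _ _ lk ge).
  right; apply: (good_vertex_near _ _ _ c _ _ _ n0 lk ge) => t; last by have [] := ce t.
  apply: (in_dyad_ancestor k l j); [exact: ltnW|exact: ltnW|].
  exact: (good_vertex_ancestor _ _ _ _ _ jk gc).
pose f s := grid_walk (cell u) (cell w) s.
have fk s t : (f s t < 2 ^ k)%N.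
  by have := cell_lt u t; have := cell_lt w t; rewrite /f /grid_walk; case: ifP; lia.
have f0 : f 0%N = cell u.
  by apply/funext => t; rewrite /f /grid_walk; case: ifP; lia.
have fe : f (2 ^ k)%N = cell w.
  apply/funext => t; have := cell_lt u t; have := cell_lt w t.
  by rewrite /f /grid_walk; case: ifP; lia.
(* One hop from [u] to the good vertex of its cell, [2 ^ k] hops along the walk, and one hop to
   [w]. *)
exists (rcons (map (v \o f) (iota 0 (2 ^ k).+1)) w).
split; first by rewrite size_rcons size_map size_iota.
split; last by rewrite last_rcons.
rewrite rcons_path /= f0; apply/andP; split.
  apply/andP; split; first by have [] := vcell u.
  rewrite -f0; apply: (path_map_iota _ _ (v \o f)) => s; apply: vv => // t.
  by rewrite /f /grid_walk; case: ifP; lia.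
have -> : last (v (cell u)) [seq (v \o f) i | i <- iota 1 (2 ^ k)] = v (f (2 ^ k)%N).
  rewrite -f0 (last_map (v \o f)) -nth_last size_iota.
  have [->|k0] := posnP (2 ^ k)%N; first by [].
  by rewrite nth_iota ?prednK//= add1n prednK.
by rewrite fe; have [] := vcell w.
Qed.

Lemma diam_le_gconnected n k (X : seq (mpoint R dim)) : diam_le n X k -> gconnected n X.
Proof.
move=> H i j; have [p [_ [pp pl]]] := H i j.
by apply/connectP; exists p.
Qed.

Lemma diam_le_leq n k l (X : seq (mpoint R dim)) : (k <= l)%N -> diam_le n X k -> diam_le n X l.
Proof.
move=> kl H i j; have [p [sp ?]] := H i j.
by exists p; split => //; exact: leq_trans kl.
Qed.

End torus_geometry.

Arguments good_vertex_radius {R} dim n j.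

(** * Void probabilities of the marked Poisson process *)

Lemma nneseries_exp {R : realType} (x : R) : 0 <= x ->
  (\sum_(0 <= m <oo) (x ^+ m / m`!%:R)%:E = (expR x)%:E)%E.
Proof.
move=> x0; rewrite expRE -EFin_lim; last first.
  rewrite /pseries/=; under eq_fun do rewrite mulrC.
  exact: is_cvg_series_exp_coeff.
apply/congr_lim/funext => n/=; rewrite /pseries/= /series/= -sumEFin//.
by under eq_bigr do rewrite mulrC.
Qed.

Section void_probability.
Context {R : realType} {d : measure_display} {Om : measurableType d}.
Context {P : probability Om R} {dim n : nat} {muR : probability R R}.
Context {N : Om -> nat} {U : nat -> 'I_dim -> Om -> R} {M : nat -> Om -> R}.
Hypothesis n0 : (0 < n)%N.
Hypothesis dim0 : (0 < dim)%N.
Hypothesis PPP : is_marked_PPP P dim n muR N U M.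

Let p A := fine (P A).

Let pE A : measurable A -> P A = (p A)%:E.
Proof. by move=> mA; rewrite fineK//; exact: fin_num_measure. Qed.

Definition ppp_events (x : ppp_index dim) : set (set Om) :=
  match x with
  | None => nat_rv_events N
  | Some (i, None) => rv_events (M i)
  | Some (i, Some t) => rv_events (U i t)
  end.

Lemma nat_rv_events_measurable (B : set nat) : measurable (N @^-1` B).
Proof.
have [[mN _] _ _ _ _] := PPP.
rewrite (_ : _ @^-1` _ = \bigcup_(m in B) (N @^-1` [set m])).
  by apply: bigcup_measurable => m _; exact: mN.
by apply/seteqP; split => w /=; [exists (N w)|case=> m Bm /= ->].
Qed.

Lemma ppp_events_measurable x A : ppp_events x A -> measurable A.
Proof.
have [[mN [mU mM]] _ _ _ _] := PPP.
case: x => [[i [t|]]|] /=.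
- by case=> B mB ->; exact: (measurable_preimage (mU i t) mB).
- by case=> B mB ->; exact: (measurable_preimage (mM i) mB).
- by case=> B ->; exact: nat_rv_events_measurable.
Qed.

Lemma ppp_cylinder (J : seq (ppp_index dim)) (A : ppp_index dim -> set Om) :
  uniq J -> (forall x, ppp_events x (A x)) ->
  p (\big[setI/setT]_(x <- J) A x) = \prod_(x <- J) p (A x).
Proof.
move=> uJ FA; have [_ _ _ _ indep] := PPP.
have /(_ uJ) := indep J A; rewrite /p => -> //; last by move=> x _; exact: FA.
have -> : (\prod_(x <- J) P (A x))%E = (\prod_(x <- J) p (A x))%:E.
  by rewrite -prodEFin; apply: eq_bigr => x _; apply: pE; exact: ppp_events_measurable.
by [].
Qed.

Lemma ppp_bigsetI_measurable (J : seq (ppp_index dim)) (A : ppp_index dim -> set Om) :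
  (forall x, ppp_events x (A x)) -> measurable (\big[setI/setT]_(x <- J) A x).
Proof.
move=> FA; apply: bigsetI_measurable => x _; exact: ppp_events_measurable (FA x).
Qed.

Section avoid.
Variables (k : nat) (A : nat -> ppp_index dim -> set Om) (e : R).
Hypothesis FA : forall j x, ppp_events x (A j x).

Definition point_indices (s : nat) : seq (ppp_index dim) :=
  Some (s, None) :: [seq Some (s, Some t) | t <- enum 'I_dim].

Definition point_event j s : set Om := \big[setI/setT]_(x <- point_indices s) A j x.

Hypothesis A_disj : forall j l s w, (j < k)%N -> (l < k)%N ->
  point_event j s w -> point_event l s w -> j = l.
Hypothesis A_prob : forall s, \sum_(j < k) p (point_event j s) = e.

Definition avoid_set s : set Om := ~` (\big[setU/set0]_(j < k) point_event j s).

Lemma point_event_measurable j s : measurable (point_event j s).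
Proof. exact: ppp_bigsetI_measurable. Qed.

Lemma avoid_set_measurable s : measurable (avoid_set s).
Proof. by apply: measurableC; apply: bigsetU_measurable => j _; exact: point_event_measurable. Qed.

Lemma avoid_prefix_measurable s : measurable (\big[setI/setT]_(i < s) avoid_set i).
Proof. by apply: bigsetI_measurable => i _; exact: avoid_set_measurable. Qed.

Lemma mem_point_indices x s :
  (x \in point_indices s) = (if x is Some (i, _) then i == s else false).
Proof.
rewrite inE; case: x => [[i [t|]]|] /=.
- apply/orP/eqP => [[/eqP//|/mapP[t' _ [-> _]//]]|->].
  by right; apply/mapP; exists t; rewrite ?mem_enum.
- apply/orP/eqP => [[/eqP[->]//|/mapP[]//]|->]; by left.
- by apply/negbTE/negP => /mapP[].
Qed.

Lemma point_indices_uniq s : uniq (point_indices s).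
Proof.
rewrite /= map_inj_uniq ?enum_uniq ?andbT; last by move=> t t' [].
by apply/negP => /mapP[].
Qed.

(* Inclusion-exclusion on the point [s], the other factors being independent of it. *)
Lemma avoid_prefix s (J : seq (ppp_index dim)) (B : ppp_index dim -> set Om) :
  uniq J -> (forall x, ppp_events x (B x)) ->
  (forall i y, Some (i, y) \in J -> (s <= i)%N) ->
  p (\big[setI/setT]_(x <- J) B x `&` \big[setI/setT]_(i < s) avoid_set i) =
  p (\big[setI/setT]_(x <- J) B x) * (1 - e) ^+ s.
Proof.
elim: s J B => [|s IH] J B uJ FB Js; first by rewrite big_ord0 setIT expr0 mulr1.
have mB := ppp_bigsetI_measurable J B FB.
have mV := avoid_prefix_measurable s.
set G := \big[setI/setT]_(x <- J) B x in mB *.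
set V := \big[setI/setT]_(i < s) avoid_set i in mV *.
have mGV : measurable (G `&` V) by exact: measurableI.
have IHG : p (G `&` V) = p G * (1 - e) ^+ s.
  by apply: IH => // i y /Js; exact: ltnW.
have IHj j : p (G `&` V `&` point_event j s) = p G * p (point_event j s) * (1 - e) ^+ s.
  (* Conditions on [J] and on point [s] concern disjoint indices; merged into one family they form a
     cylinder to which the induction hypothesis applies. *)
  pose BA x := if x \in point_indices s then A j x else B x.
  have FBA x : ppp_events x (BA x) by rewrite /BA; case: ifP.
  have disj x : x \in J -> x \in point_indices s = false.
    rewrite mem_point_indices; case: x => [[i y]|//] /Js si.
    by apply/negbTE; rewrite gtn_eqF.
  have uJs : uniq (J ++ point_indices s).
    rewrite cat_uniq uJ point_indices_uniq andbT andTb; apply/hasPn => x xs.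
    by apply/negP => /disj; rewrite xs.
  have GE : \big[setI/setT]_(x <- J) BA x = G.
    by apply: eq_big_seq => x /disj; rewrite /BA => ->.
  have EE : \big[setI/setT]_(x <- point_indices s) BA x = point_event j s.
    by apply: eq_big_seq => x xs; rewrite /BA xs.
  have catE : \big[setI/setT]_(x <- J ++ point_indices s) BA x = G `&` point_event j s.
    by rewrite big_cat/= GE EE.
  have := IH (J ++ point_indices s) BA uJs FBA.
  rewrite catE setIAC => ->; last first.
    move=> i y; rewrite mem_cat mem_point_indices => /orP[/Js/ltnW//|/eqP->//].
  rewrite -catE ppp_cylinder// big_cat/= -!ppp_cylinder ?point_indices_uniq//.
  by rewrite GE EE.
have mE := point_event_measurable.
have mUE : measurable (\big[setU/set0]_(j < k) point_event j s).
  by apply: bigsetU_measurable => j _; exact: mE.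
rewrite big_ord_recr/= setIA -/V /avoid_set -setDE.
have -> : p (G `&` V `\` \big[setU/set0]_(j < k) point_event j s) =
    p (G `&` V) - p (G `&` V `&` \big[setU/set0]_(j < k) point_event j s).
  apply: EFin_inj; rewrite EFinB -!pE//; first last.
  - exact: measurableD.
  - exact: measurableI.
  by rewrite measureD// -ge0_fin_numE//; exact: fin_num_measure.
have -> : p (G `&` V `&` \big[setU/set0]_(j < k) point_event j s) =
    \sum_(j < k) p (G `&` V `&` point_event j s).
  apply: EFin_inj; rewrite -pE; last exact: measurableI.
  pose F j := if (j < k)%N then G `&` V `&` point_event j s else set0.
  have mF j : measurable (F j) by rewrite /F; case: ifP => // _; exact: measurableI.
  have tF : trivIset setT F.
    apply/trivIsetP => j l _ _ jl; rewrite /F; case: ifP => jk; last by rewrite set0I.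
    case: ifP => lk; last by rewrite setI0.
    apply/seteqP; split => w //= -[[_ wj] [_ wl]].
    by move/eqP: jl; apply; exact: (A_disj _ _ s w).
  have FE (j : 'I_k) : F j = G `&` V `&` point_event j s by rewrite /F ltn_ord.
  rewrite big_distrr/= -sumEFin; under eq_bigr do rewrite -FE.
  rewrite (measure_bigsetU P mF tF).
  by apply: eq_bigr => j _; rewrite FE; exact: (pE _ (measurableI _ _ mGV (mE j s))).
under eq_bigr do rewrite IHj.
rewrite IHG -mulr_suml -mulr_sumr A_prob exprS; ring.
Qed.

(** Splitting by the number of points gives the exponential series with argument n^dim (1 - e),
    weighted by the Poisson factor exp(-n^dim). *)
Lemma void_probability : 
  P [set w | forall i, (i < N w)%N -> avoid_set i w] = (expR (- (n%:R ^+ dim * e)))%:E.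
Proof.
have [[mN _] PN _ _ _] := PPP.
pose S m := N @^-1` [set m] `&` \big[setI/setT]_(i < m) avoid_set i.
have mS m : measurable (S m) by apply: measurableI => //; exact: avoid_prefix_measurable.
have -> : [set w | forall i, (i < N w)%N -> avoid_set i w] = \bigcup_m S m.
  apply/seteqP; split => w /=.
    move=> H; exists (N w) => //; split => //.
    by rewrite -(bigcap_mkord (N w) avoid_set) => i /= /H.
  move=> [m _ [/= -> ]]; rewrite -(bigcap_mkord m avoid_set) => H i im.
  exact: H.
have l0 : 0 < n%:R ^+ dim :> R by rewrite exprn_gt0// ltr0n.
(* [1 - e] is the probability that point 0 alone avoids all its events. *)
have e1 : 0 <= 1 - e.
  have Hnil i y : (Some (i, y) : ppp_index dim) \in [::] -> (1 <= i)%N by [].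
  have := avoid_prefix 1 [::] (A 0%N) isT (FA 0%N) Hnil.
  rewrite big_nil setTI expr1 {2}/p probability_setT mul1r => <-.
  by rewrite fine_ge0.
rewrite measure_semi_bigcup; first last.
- exact: bigcupT_measurable.
- by apply/trivIsetP => i j _ _ ij; apply/seteqP; split => w //= -[[/= Ni _] [/= Nj _]];
    move: ij; rewrite -Ni -Nj eqxx.
- exact: mS.
transitivity (\sum_(0 <= m <oo) ((expR (- n%:R ^+ dim))%:E * ((n%:R ^+ dim * (1 - e)) ^+ m / m`!%:R)%:E))%E.
  apply: eq_eseriesr => m _; transitivity ((p (S m))%:E); first exact: (pE _ (mS m)).
  rewrite -EFinM; congr EFin.
  have := avoid_prefix m [:: None] (fun x => if x is None then N @^-1` [set m] else A 0%N x) isT.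
  rewrite big_seq1 /S => -> //; last by case=> [[? ?]|] /=; [exact: (FA 0%N (Some _))|exists [set m]].
  rewrite {1}/p PN /poisson_pmf l0 /= exprMn; ring.
rewrite nneseriesZl; last by move=> m _; rewrite lee_fin divr_ge0// exprn_ge0// mulr_ge0// ltW.
rewrite nneseries_exp ?mulr_ge0 ?(ltW l0)// -EFinM -expRD; congr (expR _)%:E; ring.
Qed.

End avoid.
End void_probability.

(** * Probability of covering all boxes *)

Lemma bigsetI_seqP {T : Type} {I : eqType} (s : seq I) (F : I -> set T) w :
  (\big[setI/setT]_(i <- s) F i) w <-> forall i, i \in s -> F i w.
Proof.
elim: s => [|i s IH]; first by rewrite big_nil.
rewrite big_cons; split => [[Fi /IH H] j|H].
  by rewrite inE => /predU1P[->//|/H].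
by split; [apply: H; rewrite mem_head|apply/IH => j js; apply: H; rewrite inE js orbT].
Qed.

Lemma measure_bigsetU_seq_le {d} {T : measurableType d} {R : realType} {I : eqType}
    (P : probability T R) (s : seq I) (F : I -> set T) :
  (forall i, measurable (F i)) ->
  (P (\big[setU/set0]_(i <- s) F i) <= \sum_(i <- s) P (F i))%E.
Proof.
move=> mF; elim: s => [|i s IH]; first by rewrite !big_nil measure0.
rewrite !big_cons; apply: (le_trans (measureU2 _ _ _)) => //.
  by apply: bigsetU_measurable.
exact: leeD.
Qed.

Lemma powR_half {R : realType} (m : nat) : (m%:R : R) `^ (m%:R / 2) = Num.sqrt m%:R ^+ m.
Proof.
rewrite mulrC powRrM powR12_sqrt ?ler0n// powR_mulrn//.
Qed.

(** Keeps the region inside the unit cube, so that each coordinate condition has probability exactly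
    2^(-level). *)
Lemma good_vertex_index_lt k (dim : nat) (c : 'I_dim -> nat) j t : (j < k)%N -> (c t < 2 ^ k)%N ->
  (good_vertex_index k c j t < 2 ^ good_vertex_level j t)%N.
Proof.
move=> jk ck; have anc l : (l <= k)%N -> (ancestor k l (c t) < 2 ^ l)%N.
  by move=> lk; rewrite /ancestor ltn_divLR ?expn_gt0// -expnD subnKC.
rewrite /good_vertex_index /good_vertex_level; case: ifP => _; last exact: anc (ltnW jk).
have := anc _ jk; rewrite expnS /sibling; case: ifP => ?; lia.
Qed.

Section coverage.
Context {R : realType} {d : measure_display} {Om : measurableType d}.
Context {P : probability Om R} {dim n : nat} {muR : probability R R}.
Context {N : Om -> nat} {U : nat -> 'I_dim -> Om -> R} {M : nat -> Om -> R}.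
Hypothesis n0 : (0 < n)%N.
Hypothesis dim0 : (0 < dim)%N.
Hypothesis PPP : is_marked_PPP P dim n muR N U M.

Let n0R : 0 < n%:R :> R. Proof. by rewrite ltr0n. Qed.

Definition point_of i w : mpoint R dim := ((fun t => U i t w), M i w).

Definition tail (h : R) : R := fine (muR `]h, +oo[%classic).

Lemma in_dyad_setE l a : [set x : R | in_dyad l a (unit_coord n x)] =
  `[n%:R * (a%:R / 2 ^+ l - 2^-1), n%:R * (a.+1%:R / 2 ^+ l - 2^-1)[%classic.
Proof.
have p0 : 0 < 2 ^+ l :> R by rewrite exprn_gt0.
suff H (x : R) : in_dyad l a (unit_coord n x) =
    (n%:R * (a%:R / 2 ^+ l - 2^-1) <= x < n%:R * (a.+1%:R / 2 ^+ l - 2^-1)).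
  by apply/seteqP; split => x /=; rewrite in_itv/= H.
have : x = n%:R * (x / n%:R) by rewrite mulrC divfK// gt_eqF.
rewrite /in_dyad /unit_coord; move: (x / n%:R) => z ->.
rewrite ler_pM2l// ltr_pM2l// lerBlDr ltrBrDr ler_pdivrMr// ltr_pdivlMr//.
by rewrite [2 ^+ l * _]mulrC.
Qed.

Lemma coord_prob i t l a : (a < 2 ^ l)%N ->
  P (U i t @^-1` [set x | in_dyad l a (unit_coord n x)]) = (2^-1 ^+ l)%:E.
Proof.
move=> al; have [_ _ PU _ _] := PPP; rewrite in_dyad_setE PU; last exact: measurable_itv.
have p0 : 0 < 2 ^+ l :> R by rewrite exprn_gt0.
rewrite setIidl.
  rewrite lebesgue_measure_itv/= lte_fin ifT.
    rewrite -EFinD -EFinM; congr EFin.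
    rewrite exprVn -natr1; move: (2 ^+ l) p0 => D D0.
    by field; rewrite !gt_eqF.
  by rewrite ltr_pM2l// ltrD2r ltr_pM2r ?invr_gt0// ltr_nat.
move=> x /=; rewrite !in_itv/= => /andP[ax xa]; apply/andP; split.
  by apply: le_trans ax; rewrite -mulrN ler_pM2l// lerDr divr_ge0// ltW.
apply: (le_trans (ltW xa)); rewrite ler_pM2l// lerBlDr (_ : 2^-1 + 2^-1 = 1); last lra.
by rewrite ler_pdivrMr// mul1r -natrX ler_nat.
Qed.

Variable k : nat.

(** The index [None] stands for the number of points, on which no condition is imposed. *)
Definition region_event (c : 'I_dim -> nat) j (x : ppp_index dim) : set Om :=
  match x with
  | None => N @^-1` setT
  | Some (i, None) => M i @^-1` `]good_vertex_radius dim n j, +oo[%classic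
  | Some (i, Some t) => U i t @^-1`
      [set x | in_dyad (good_vertex_level j t) (good_vertex_index k c j t) (unit_coord n x)]
  end.

Lemma region_event_ppp c j x : ppp_events (N := N) (U := U) (M := M) x (region_event c j x).
Proof.
case: x => [[i [t|]]|] /=; last by exists setT.
  by eexists; last reflexivity; rewrite in_dyad_setE; exact: measurable_itv.
by eexists; last reflexivity; exact: measurable_itv.
Qed.

Lemma point_eventE c j s w :
  point_event (region_event c) j s w <-> good_vertex n k c j (point_of s w).
Proof.
rewrite /point_event bigsetI_seqP /good_vertex; split => [H|/andP[/forallP H r] x].
  apply/andP; split; last first.
    have := H (Some (s, None)); rewrite mem_point_indices eqxx => /(_ isT) /=.
    by rewrite in_itv/= andbT.
  apply/forallP => t; have := H (Some (s, Some t)).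
  by rewrite mem_point_indices eqxx => /(_ isT).
rewrite mem_point_indices; case: x => [[i [t|]]|//] /eqP -> /=; first exact: H.
by rewrite in_itv/= andbT.
Qed.

(** In direction 0 the region of level [j] lies in the sibling of the ancestor at level [j.+1],
    while the regions of deeper levels lie inside that ancestor. *)
Lemma region_event_disjoint c j l s w : (j < k)%N -> (l < k)%N ->
  point_event (region_event c) j s w -> point_event (region_event c) l s w -> j = l.
Proof.
rewrite !point_eventE.
have W j' l' : (l' < k)%N -> (j' < l')%N ->
    good_vertex n k c j' (point_of s w) -> good_vertex n k c l' (point_of s w) -> False.
  move=> lk jl /andP[/forallP/(_ (Ordinal dim0)) H _] /(good_vertex_ancestor _ _ _ _ _ lk)/(_ (Ordinal dim0)) H'.
  have {}H' := in_dyad_ancestor _ _ _ _ _ jl (ltnW lk) H'.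
  rewrite /good_vertex_level /good_vertex_index/= in H.
  by have := in_dyad_inj _ _ _ _ H H' => /eqP; rewrite (negbTE (sibling_neq _)).
move=> jk lk gj gl; have [jl|lj|//] := ltngtP j l.
  by have := W _ _ lk jl gj gl.
by have := W _ _ jk lj gl gj.
Qed.

(** The probability that one point is good for a fixed cell. The exponent counts [j] halvings in
    each of the [dim] directions and one more in direction 0. *)
Definition coverage_rate : R :=
  \sum_(j < k) (2^-1 ^+ (j * dim).+1 * tail (good_vertex_radius dim n j)).

Lemma region_event_prob c s : (forall t, (c t < 2 ^ k)%N) ->
  \sum_(j < k) fine (P (point_event (region_event c) j s)) = coverage_rate.
Proof.
move=> ck; apply: eq_bigr => j _; have [_ _ _ PM _] := PPP.
rewrite (ppp_cylinder PPP _ _ (point_indices_uniq s) (region_event_ppp c j)).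
rewrite /point_indices big_cons big_map big_enum/= PM; last exact: measurable_itv.
rewrite mulrC; congr (_ * _).
under eq_bigr => t _ do rewrite coord_prob ?good_vertex_index_lt//=.
rewrite prodrXr; congr (_ ^+ _).
have gE (t : 'I_dim) : good_vertex_level j t = (j + (t == 0%N :> nat))%N.
  by rewrite /good_vertex_level; case: eqP => _; rewrite ?addn1 ?addn0.
under eq_bigr do rewrite gE.
rewrite big_split/= sum_nat_const card_ord mulnC -addn1; congr addn.
rewrite (bigD1 (Ordinal dim0))//= big1// => t; rewrite -val_eqE/=.
by move=> /negbTE ->.
Qed.

Definition uncovered (c : 'I_dim -> nat) : set Om :=
  [set w | forall i, (i < N w)%N -> ~ exists2 j, (j < k)%N & good_vertex n k c j (point_of i w)].

Lemma avoid_setE c s w : avoid_set k (region_event c) s w <->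
  ~ exists2 j, (j < k)%N & good_vertex n k c j (point_of s w).
Proof.
rewrite /avoid_set -(bigcup_mkord k (fun j => point_event (region_event c) j s)); split => H; apply: contra_not H.
  by move=> [j jk g]; exists j => //; exact/point_eventE.
by move=> [j jk /point_eventE g]; exists j.
Qed.

Lemma uncoveredE c : uncovered c =
  [set w | forall i, (i < N w)%N -> avoid_set k (region_event c) i w].
Proof.
by apply/seteqP; split => w H i iN; [apply/avoid_setE; exact: H|exact/avoid_setE/H].
Qed.

Lemma uncovered_measurable c : measurable (uncovered c).
Proof.
rewrite uncoveredE (_ : mkset _ = \bigcup_m (N @^-1` [set m] `&`
    \big[setI/setT]_(i < m) avoid_set k (region_event c) i)).
  apply: bigcupT_measurable => m; apply: measurableI.
    exact: (nat_rv_events_measurable PPP).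
  exact: (avoid_prefix_measurable PPP _ _ (region_event_ppp c)).
apply/seteqP; split => w /=.
  by move=> H; exists (N w) => //; split => //; rewrite -bigcap_mkord => i /= /H.
by move=> [m _ [/= -> ]]; rewrite -bigcap_mkord => H i im; exact: H.
Qed.

Lemma uncovered_prob c : (forall t, (c t < 2 ^ k)%N) ->
  P (uncovered c) = (expR (- (n%:R ^+ dim * coverage_rate)))%:E.
Proof.
move=> ck; rewrite uncoveredE.
apply: (void_probability n0 PPP _ _ _ (region_event_ppp c)).
- by move=> j l s w; exact: region_event_disjoint.
- by move=> s; exact: region_event_prob.
Qed.

Definition cell_of (c : {ffun 'I_dim -> 'I_(2 ^ k)}) (t : 'I_dim) : nat := c t.

Definition covered : set Om :=
  ~` (\big[setU/set0]_(c <- enum {ffun 'I_dim -> 'I_(2 ^ k)}) uncovered (cell_of c)).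

Lemma covered_measurable : measurable covered.
Proof.
by apply: measurableC; apply: bigsetU_measurable => c _; exact: uncovered_measurable.
Qed.

Lemma covered_prob : (P (~` covered) <=
  ((2 ^+ (k * dim)) * expR (- (n%:R ^+ dim * coverage_rate)))%:E)%E.
Proof.
rewrite /covered setCK.
apply: (le_trans (measure_bigsetU_seq_le _ _ _ (fun c => uncovered_measurable (cell_of c)))).
rewrite (eq_bigr (fun=> (expR (- (n%:R ^+ dim * coverage_rate)))%:E)); last first.
  by move=> c _; rewrite uncovered_prob// => t; exact: ltn_ord.
rewrite sumEFin lee_fin big_enum/= sumr_const card_ffun !card_ord -expnM.
by rewrite -[leLHS]mulr_natl natrX.
Qed.

Lemma coveredP w : covered w -> forall c : 'I_dim -> nat, (forall t, (c t < 2 ^ k)%N) ->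
  exists i j, [/\ (i < N w)%N, (j < k)%N & good_vertex n k c j (point_of i w)].
Proof.
move=> cw c ck; apply: contrapT => H; apply: cw.
rewrite -bigcup_seq; exists [ffun t => Ordinal (ck t)] => /=; first by rewrite mem_enum.
move=> i iN [j jk g]; apply: H; exists i, j; split => //.
by rewrite (_ : c = cell_of [ffun t => Ordinal (ck t)])//; apply/funext => t; rewrite /cell_of ffunE.
Qed.

Variable H0 : R.
Hypothesis H00 : 0 < H0.
Hypothesis tail_ge : forall h, H0 <= h ->
  dim%:R `^ (dim%:R / 2) * 2 ^+ (2 * dim + 1) * dim.+1%:R * ln 2 <= h ^+ dim * tail h.
Hypothesis n_large : H0 * 2 ^+ k <= n%:R.

(** Each of the [k] levels contributes at least 2^dim (dim+1) ln 2. [n_large] keeps all radii above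
    [H0], and inserting the radius into [tail_ge] cancels the factor sqrt(dim)^dim together with the
    powers of 2^j, which is why the bound does not depend on the level. *)
Lemma coverage_rate_ge : (k * (2 ^ dim * dim.+1))%:R * ln 2 <= n%:R ^+ dim * coverage_rate.
Proof.
have sq1 : 1 <= Num.sqrt dim%:R :> R.
  by rewrite -[leLHS]sqrtr1 ler_wsqrtr// -[1]/(1%:R) ler_nat.
have sq0 : 0 < Num.sqrt dim%:R :> R by rewrite (lt_le_trans _ sq1).
rewrite natrM -mulrA -[k in k%:R]card_ord mulr_natl -sumr_const /coverage_rate mulr_sumr.
apply: ler_sum => j _.
have p0 m : 0 < 2 ^+ m :> R by rewrite exprn_gt0.
have rj : H0 <= good_vertex_radius dim n j :> R.
  rewrite /good_vertex_radius (@le_trans _ _ (2 * n%:R / 2 ^+ j))//; last first.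
    by rewrite ler_peMl// divr_ge0// ?mulr_ge0 ?ltW.
  rewrite ler_pdivlMr//; apply: (@le_trans _ _ (H0 * 2 ^+ k)).
    by rewrite ler_pM2l// ler_eXn2l ?ltr1n// ltnW.
  by apply: (le_trans n_large); rewrite ler_peMl ?ltW ?ltr1n.
have := tail_ge _ rj; rewrite powR_half.
set T := tail _; set s := Num.sqrt _.
have -> : good_vertex_radius dim n j ^+ dim = s ^+ dim * (2 ^+ dim * n%:R ^+ dim / (2 ^+ j) ^+ dim).
  by rewrite /good_vertex_radius -/s !exprMn exprVn.
rewrite -!mulrA ler_pM2l ?exprn_gt0// => H.
rewrite exprVn exprS natrM natrX exprM.
rewrite addn1 exprS mul2n -addnn exprD in H.
set J := (2 ^+ j) ^+ dim in H *.
have J0 : 0 < J by rewrite exprn_gt0.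
have D0 : 0 < 2 ^+ dim :> R by [].
rewrite invfM.
have : 2 ^+ dim * (2 * (2 ^+ dim * (dim.+1%:R * ln 2))) <= 2 ^+ dim * (n%:R ^+ dim * (J^-1 * T)).
  by apply: le_trans H; rewrite le_eqVlt; apply/orP; left; apply/eqP; ring.
rewrite ler_pM2l//.
move: (ln 2) (n%:R ^+ dim) (J^-1) (2 ^+ dim) => L a b D HH.
have -> : a * (2^-1 * b * T) = 2^-1 * (a * (b * T)) by ring.
by have := HH; lra.
Qed.

Lemma uncovered_small : (2 <= dim)%N -> (P (~` covered) <= (2^-1 ^+ (5 * k))%:E)%E.
Proof.
move=> dim2; apply: (le_trans covered_prob); rewrite lee_fin.
pose m := (k * (2 ^ dim * dim.+1))%N.
have e : expR (- (m%:R * ln 2)) = 2^-1 ^+ m :> R.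
  by rewrite -mulrN expRM_natl expRN lnK// posrE.
have : expR (- (n%:R ^+ dim * coverage_rate)) <= 2^-1 ^+ m.
  by rewrite -e ler_expR lerN2; exact: coverage_rate_ge.
move=> H; apply: (@le_trans _ _ (2 ^+ (k * dim) * 2^-1 ^+ m)).
  by rewrite ler_pM2l// exprn_gt0.
(* For dim >= 2 one has 2^dim (dim+1) >= 4 (dim+1) >= dim + 5: [dim] pays for the number of cells
   and 5 remains. *)
have mk : (k * dim + 5 * k <= m)%N.
  have d4 : (4 <= 2 ^ dim)%N by rewrite -[4%N]/(2 ^ 2)%N leq_exp2l.
  rewrite mulnC -mulnDl mulnC leq_mul2l; apply/orP; right.
  by apply: (@leq_trans (4 * dim.+1)); [lia|rewrite leq_mul2r d4 orbT].
rewrite -(subnK (leq_trans (leq_addr _ _) mk)) exprD mulrCA -exprMn divff// expr1n mulr1.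
by apply: ler_wiXn2l; [lra|lra|lia].
Qed.

End coverage.

(** * Measurability of graph events *)

Section nat_valued.
Context {d : measure_display} {T : measurableType d}.

Lemma measurable_const_prop (Q : Prop) : measurable [set _ : T | Q].
Proof.
have [q|q] := pselect Q.
  have -> : [set _ : T | Q] = setT by apply/seteqP; split.
  exact: measurableT.
have -> : [set _ : T | Q] = set0 by apply/seteqP; split.
exact: measurable0.
Qed.

Definition nat_measurable (f : T -> nat) := forall k, measurable (f @^-1` [set k]).

Lemma nat_measurable_preimage f (B : set nat) : nat_measurable f -> measurable (f @^-1` B).
Proof.
move=> mf; rewrite (_ : _ @^-1` _ = \bigcup_(m in B) (f @^-1` [set m])).
  by apply: bigcup_measurable => m _; exact: mf.
by apply/seteqP; split => w /=; [exists (f w)|case=> m Bm /= ->].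
Qed.

Lemma nat_measurable_index (F : nat -> T -> nat) (g : T -> nat) :
  (forall a, nat_measurable (F a)) -> nat_measurable g ->
  nat_measurable (fun w => F (g w) w).
Proof.
move=> mF mg k.
rewrite (_ : _ @^-1` _ = \bigcup_a (g @^-1` [set a] `&` F a @^-1` [set k])).
  by apply: bigcupT_measurable => a; apply: measurableI; [exact: mg|exact: mF].
by apply/seteqP; split => w /=; [exists (g w)|case=> a _ /= [-> ->]].
Qed.

Lemma nat_measurable_comp (h : nat -> nat) f : nat_measurable f -> nat_measurable (h \o f).
Proof. by move=> mf k; exact: (nat_measurable_preimage f (h @^-1` [set k]) mf). Qed.

Lemma nat_measurable_sum (F : nat -> T -> nat) m : (forall a, nat_measurable (F a)) ->
  nat_measurable (fun w => \sum_(j < m) F j w)%N.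
Proof.
move=> mF; elim: m => [|m IH] k.
  rewrite (_ : _ @^-1` _ = [set _ | 0%N = k]); first exact: measurable_const_prop.
  by apply/seteqP; split => w /=; rewrite big_ord0.
rewrite (_ : (fun w => _) = (fun w => (\sum_(j < m) F j w) + F m w)%N); last first.
  by apply/funext => w; rewrite big_ord_recr.
apply: (nat_measurable_index (fun a w => (a + F m w)%N)) => // a.
exact: (nat_measurable_comp (addn a)).
Qed.

Lemma gw_gen_measurable (xi : nat -> nat -> T -> nat) t :
  (forall t j, nat_measurable (xi t j)) -> nat_measurable (gw_gen xi t).
Proof.
move=> mxi; elim: t => [|t IH] /=.
  by move=> k; exact: measurable_const_prop.
apply: (nat_measurable_index (fun a w => (\sum_(j < a) xi t j w)%N)) => // a.
exact: nat_measurable_sum.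
Qed.

Lemma gw_total_progeny_measurable (xi : nat -> nat -> T -> nat) m :
  (forall t j, nat_measurable (xi t j)) -> measurable [set w | gw_total_progeny xi w m].
Proof.
move=> mxi; rewrite (_ : mkset _ = \bigcup_t0 (gw_gen xi t0 @^-1` [set 0%N] `&`
   (fun w => \sum_(t < t0) gw_gen xi t w)%N @^-1` [set m])).
  apply: bigcupT_measurable => t; apply: measurableI; first exact: gw_gen_measurable.
  by apply: nat_measurable_sum => a; exact: gw_gen_measurable.
by apply/seteqP; split => w /= [t]; [move=> [? ?]; exists t|move=> _ [? ?]; exists t].
Qed.

End nat_valued.

(** The root and its children are counted in the total progeny; no later generation is needed for
    the coupling. *)
Lemma gw_total_progeny_ge {T : Type} (xi : nat -> nat -> T -> nat) w m :
  gw_total_progeny xi w m -> (xi 0%N 0%N w < m)%N.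
Proof.
move=> [[|[|t]] [/=]]; rewrite ?big_ord1//= => x0; rewrite ?big_ord1.
  by move=> <-; rewrite x0.
rewrite -(big_mkord xpredT (fun s => gw_gen xi s w)) big_nat_recl// big_nat_recl//=.
by rewrite big_ord1 /= => <-; lia.
Qed.

Section graph_measurability.
Context {R : realType} {d : measure_display} {Om : measurableType d}.
Context {dim : nat} (n : nat).
Context {N : Om -> nat} {U : nat -> 'I_dim -> Om -> R} {M : nat -> Om -> R}.
Hypothesis mN : nat_measurable N.
Hypothesis mU : forall i t, measurable_fun setT (U i t).
Hypothesis mM : forall i, measurable_fun setT (M i).

(** Adjacency on plain indices: the vertex type of [gadj] varies with [w], whereas measurability
    needs events attached to fixed indices. *)
Definition config_adj w (i j : nat) : bool :=
  (torus_dist n (fun t => U i t w) (fun t => U j t w) <= M i w) ||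
  (torus_dist n (fun t => U j t w) (fun t => U i t w) <= M j w).

Lemma measurable_circ_dist : measurable_fun setT (@circ_dist R n).
Proof.
have mdiv : measurable_fun setT (fun t : R => t / n%:R) by exact: measurable_funM.
have mfl : measurable_fun setT (fun t : R => (Num.floor (t / n%:R))%:~R : R).
  apply: (measurableT_comp (g := fun t : R => t / n%:R) (f := fun t : R => (Num.floor t)%:~R : R)) => //.
  apply: nondecreasing_measurable => // x y xy.
  by rewrite ler_int; exact: le_floor.
have mu : measurable_fun setT (fun t : R => t / n%:R - (Num.floor (t / n%:R))%:~R).
  exact: measurable_funB.
apply: measurable_funM => //; apply: measurable_minr => //.
exact: measurable_funB.
Qed.

Lemma config_adj_measurable i j : measurable [set w | config_adj w i j].
Proof.
have mT i' j' : measurable_fun setT (fun w => torus_dist n (fun t => U i' t w) (fun t => U j' t w)).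
  apply: (measurableT_comp (f := @Num.sqrt R)).
    by apply: nondecreasing_measurable => // x y; exact: ler_wsqrtr.
  apply: measurable_sum => t; apply: measurable_funX.
  apply: (measurableT_comp measurable_circ_dist).
  exact: measurable_funB.
have mA i' j' : measurable [set w | torus_dist n (fun t => U i' t w) (fun t => U j' t w) <= M i' w].
  exact: (measurable_preimage (A := [set true]) (measurable_fun_ler (mT i' j') (mM i'))).
rewrite (_ : mkset _ = [set w | torus_dist n (fun t => U i t w) (fun t => U j t w) <= M i w] `|`
   [set w | torus_dist n (fun t => U j t w) (fun t => U i t w) <= M j w]).
  by apply: measurableU; exact: mA.
by apply/seteqP; split => w /=; [move/orP|move=> H; apply/orP].
Qed.

Lemma config_path_measurable i (p : seq nat) : measurable [set w | path (config_adj w) i p].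
Proof.
elim: p i => [|j p IH] i /=; first by rewrite (_ : mkset _ = setT)//; apply/seteqP.
rewrite (_ : mkset _ = [set w | config_adj w i j] `&` [set w | path (config_adj w) j p]).
  by apply: measurableI => //; exact: config_adj_measurable.
by apply/seteqP; split => w /=; [move/andP|move=> H; apply/andP].
Qed.

Lemma size_marked_config w : size (marked_config N U M w) = N w.
Proof. by rewrite size_map size_iota. Qed.

Lemma nth_marked_config w i p0 : (i < N w)%N ->
  nth p0 (marked_config N U M w) i = ((fun t => U i t w), M i w).
Proof. by move=> iN; rewrite (nth_map 0%N) ?size_iota// nth_iota. Qed.

Lemma gadj_marked_config w (i j : 'I_(size (marked_config N U M w))) :
  gadj n (marked_config N U M w) i j = config_adj w i j.
Proof.
by rewrite /gadj !nth_marked_config// -size_marked_config; exact: ltn_ord.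
Qed.

Lemma chem_dist_leP w (i j : 'I_(size (marked_config N U M w))) m :
  chem_dist_le n (marked_config N U M w) i j m <->
  exists p : seq nat, [/\ (size p <= m)%N, all (fun a => a < N w)%N p,
    path (config_adj w) i p & last (i : nat) p = j].
Proof.
split => [[p [sp [pp pl]]]|[p [sp pN pp pl]]].
  exists (map (fun a => nat_of_ord a) p); rewrite size_map last_map pl; split => //.
    apply/allP => _ /mapP[a _ ->]; rewrite -size_marked_config; exact: ltn_ord.
  by rewrite path_map; apply: sub_path pp => a b; rewrite gadj_marked_config.
have [q qp] : exists q : seq 'I_(size (marked_config N U M w)), map (fun a => nat_of_ord a) q = p.
  elim: p pN {sp pp pl} => [|a p IH] /=; first by exists [::].
  move=> /andP[aN /IH[q <-]]; rewrite -size_marked_config in aN.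
  by exists (Ordinal aN :: q).
subst p; rewrite size_map in sp; rewrite last_map in pl.
exists q; split => //; split; last exact: val_inj.
by move: pp; rewrite path_map; apply: sub_path => a b; rewrite /= gadj_marked_config.
Qed.

Lemma diam_le_measurable m : measurable [set w | diam_le n (marked_config N U M w) m].
Proof.
pose C i j (p : seq nat) : set Om := N @^-1` [set a | all (fun x => x < a)%N p] `&`
  [set w | path (config_adj w) i p] `&` [set w | (size p <= m)%N && (last i p == j)].
have mC i j p : measurable (C i j p).
  apply: measurableI; last first.
    exact: measurable_const_prop.
  by apply: measurableI; [exact: nat_measurable_preimage|exact: config_path_measurable].
(* Either one of the two indices is not a vertex, or one of countably many index sequences,
   enumerated by [unpickle], is a short enough path. *)
pose D i j : set Om := N @^-1` [set a | (a <= i)%N || (a <= j)%N] `|`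
  \bigcup_s (if @unpickle (seq nat) s is Some p then C i j p else set0).
have mD i j : measurable (D i j).
  apply: measurableU; first exact: nat_measurable_preimage.
  by apply: bigcupT_measurable => s; case: unpickle.
rewrite (_ : mkset _ = \bigcap_i \bigcap_j D i j).
  by apply: bigcapT_measurable => i; apply: bigcapT_measurable => j.
apply/seteqP; split => w /=.
  move=> H i _ j _; have [iN|iN] := leqP (N w) i; first by left; rewrite /= iN.
  have [jN|jN] := leqP (N w) j; first by left; rewrite /= jN orbT.
  right; rewrite -size_marked_config in iN; rewrite -size_marked_config in jN.
  have /chem_dist_leP[p [sp pN pp pl]] := H (Ordinal iN) (Ordinal jN).
  exists (pickle p) => //; rewrite pickleK; split; first by split.
  by rewrite /= sp /= pl eqxx.
move=> H i j; apply/chem_dist_leP.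
have := H i I j I; case=> [/=|[s _]].
  have iN := ltn_ord i; have jN := ltn_ord j.
  rewrite [X in (_ < X)%N]size_marked_config in iN.
  rewrite [X in (_ < X)%N]size_marked_config in jN.
  by move=> /orP[]; rewrite leqNgt ?iN ?jN.
case: unpickle => // p [[pN pp] /andP[sp /eqP pl]]; exists p; split => //.
Qed.

(** A connected finite graph has finite diameter, since a walk can be shortened to a path without
    repetition; connectivity is thus a countable union of diameter events. *)
Lemma gconnected_measurable : measurable [set w | gconnected n (marked_config N U M w)].
Proof.
rewrite (_ : mkset _ = \bigcup_m [set w | diam_le n (marked_config N U M w) m]).
  by apply: bigcupT_measurable => m; exact: diam_le_measurable.
apply/seteqP; split => w /=; last by move=> [m _]; exact: diam_le_gconnected.
move=> H; set X := marked_config N U M w in H *.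
exists (size X) => // i j; have /connectP[p pp pl] := H i j.
case/shortenP: pp pl => p' pp' up' _ pl; exists p'; split => //.
by have := card_uniqP up'; have := max_card (mem (i :: p')); rewrite card_ord /= => + E; rewrite E /=; exact: ltnW.
Qed.

End graph_measurability.

(** * Almost sure confinement to the half-open box *)

Section box.
Context {R : realType} {d : measure_display} {Om : measurableType d}.
Context {P : probability Om R} {dim n : nat} {muR : probability R R}.
Context {N : Om -> nat} {U : nat -> 'I_dim -> Om -> R} {M : nat -> Om -> R}.
Hypothesis n0 : (0 < n)%N.
Hypothesis PPP : is_marked_PPP P dim n muR N U M.

(** The half-open dyadic boxes miss the right end of the closed interval on which the coordinates
    are uniform; this costs a null event. *)
Definition in_box : set Om := [set w | forall i t, in_dyad 0 0 (unit_coord n (U i t w))].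

Lemma in_boxE : ~` in_box = \bigcup_i \big[setU/set0]_(t <- enum 'I_dim)
  (~` (U i t @^-1` [set x | in_dyad 0 0 (unit_coord n x)])).
Proof.
apply/seteqP; split => w /=.
  move=> /existsNP[i /existsNP[t H]]; exists i => //.
  by rewrite -bigcup_seq; exists t => //=; rewrite mem_enum.
by move=> [i _]; rewrite -bigcup_seq => -[t _ H] /(_ i t).
Qed.

Lemma coord_in_measurable i t :
  measurable (~` (U i t @^-1` [set x | in_dyad 0 0 (unit_coord n x)])).
Proof.
have [[_ [mU _]] _ _ _ _] := PPP; apply: measurableC.
by apply: (measurable_preimage (mU i t)); rewrite in_dyad_setE//; exact: measurable_itv.
Qed.

Lemma in_box_measurable : measurable in_box.
Proof.
rewrite -(setCK in_box) in_boxE; apply: measurableC; apply: bigcupT_measurable => i.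
by apply: bigsetU_measurable => t _; exact: coord_in_measurable.
Qed.

Lemma in_box_prob : P (~` in_box) = 0%E.
Proof.
have mB i : measurable (\big[setU/set0]_(t <- enum 'I_dim)
    (~` (U i t @^-1` [set x | in_dyad 0 0 (unit_coord n x)]))).
  by apply: bigsetU_measurable => t _; exact: coord_in_measurable.
apply/eqP; rewrite eq_le measure_ge0 andbT in_boxE.
apply: (le_trans (generalized_Boole_inequality P mB (bigcupT_measurable _ mB))).
rewrite eseries0// => i _ _; apply/eqP; rewrite eq_le measure_ge0 andbT.
apply: (le_trans (measure_bigsetU_seq_le _ _ _ (coord_in_measurable i))).
rewrite big1// => t _; rewrite probability_setC; last first.
  by rewrite -[X in measurable X]setCK; apply: measurableC; exact: coord_in_measurable.
by rewrite (coord_prob n0 PPP)// expr0 subee.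
Qed.

Lemma covered_in_box_diam k w :
  covered (n := n) (N := N) (U := U) (M := M) k w -> in_box w ->
  diam_le n (marked_config N U M w) (2 + 2 ^ k).
Proof.
move=> cw bw; apply: covered_diam_le => // [i t|c ck].
  rewrite nth_marked_config -?(size_marked_config (N := N) (U := U) (M := M))//=.
  by have := bw i t; rewrite /in_dyad expr0 mul1r.
have [i [j [iN jk g]]] := coveredP _ _ cw c ck.
have iX : (i < size (marked_config N U M w))%N by rewrite size_marked_config.
by exists (Ordinal iX), j; split => //=; rewrite nth_marked_config.
Qed.

End box.

(** * Offspring law and realization of the Poisson process *)

Lemma nneseries_EFinP {R : realType} (q : nat -> R) (l : R) : (forall k, 0 <= q k) ->
  (\sum_(0 <= k <oo) (q k)%:E = l%:E)%E <->
  (fun n => \sum_(0 <= k < n) q k) @ \oo --> l.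
Proof.
move=> q0; split => [ql|H].
  have : (fun n => (\sum_(0 <= k < n) q k)%:E) @ \oo --> l%:E.
    rewrite -ql; under eq_fun do rewrite -sumEFin.
    by apply: is_cvg_nneseries => k _ _; rewrite lee_fin.
  exact: fine_cvg.
apply/cvg_lim => //; under eq_fun do rewrite sumEFin.
by apply: cvg_EFin; [exact: nearW|exact: H].
Qed.

Section offspring.
Context {R : realType}.

(* The tail decays fast enough for a finite mean, but only polynomially, since the
   diameter bound [2 + 2 ^ k] holds up to a probability exponentially small in [k]. *)
Definition offspring (m : nat) : R :=
  if m is 0%N then 11 / 12 else (m.+1%:R * m.+2%:R * m.+3%:R)^-1.

Lemma offspring_ge0 m : 0 <= offspring m.
Proof. by case: m => [|m] /=; [lra|rewrite invr_ge0 !mulr_ge0]. Qed.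

(** A telescoping sum: the positive values carry mass 1/12, whence the value 11/12 at 0. *)
Lemma offspring_partial n :
  \sum_(0 <= k < n.+1) offspring k = 1 - (2 * n.+2%:R * n.+3%:R)^-1.
Proof.
elim: n => [|n IH]; first by rewrite big_nat1 /=; field.
rewrite big_nat_recr//= IH -[n.+4%:R]natr1 -[n.+3%:R]natr1 -[n.+2%:R]natr1.
have := ler0n R n.+1; move: n.+1%:R => x x0; field.
by apply/and3P; split; rewrite gt_eqF//; lra.
Qed.

(** Replacing the numerator m by m + 1 leaves 1/((m+2)(m+3)), which telescopes to 1/2 - 1/(n+2); the
    terms 1/6 and 1/3 are the share of m = 0 and the total of the others. *)
Lemma offspring_mean_partial n :
  \sum_(0 <= k < n) k%:R * offspring k <= 3^-1 - (n.+2)%:R^-1 + 6^-1 :> R.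
Proof.
elim: n => [|n IH]; first by rewrite big_geq//; lra.
rewrite big_nat_recr//=; apply: (le_trans (lerD IH (lexx _))).
case: n {IH} => [|n]; first by rewrite /= mul0r; lra.
rewrite /= -[n.+4%:R]natr1 -[n.+3%:R]natr1 -[n.+2%:R]natr1.
have := ler0n R n.+1; move: n.+1%:R => x x0; rewrite -subr_ge0.
have -> : 3^-1 - (x + 1 + 1 + 1)^-1 + 6^-1 - (3^-1 - (x + 1 + 1)^-1 + 6^-1 +
    x * ((x + 1) * (x + 1 + 1) * (x + 1 + 1 + 1))^-1) =
    ((x + 1) * (x + 1 + 1) * (x + 1 + 1 + 1))^-1.
  by field; apply/and3P; split; rewrite gt_eqF//; lra.
by rewrite invr_ge0 !mulr_ge0//; lra.
Qed.

Lemma offspring_sum : (\sum_(0 <= k <oo) (offspring k)%:E = 1%:E)%E.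
Proof.
apply/nneseries_EFinP; first exact: offspring_ge0.
rewrite -cvg_shiftS; under eq_fun do rewrite offspring_partial.
suff H : (fun n => (2 * n.+2%:R * n.+3%:R)^-1 : R) @ \oo --> (0 : R).
  by have := cvgB (@cvg_cst _ (1 : R) _ \oo _) H; rewrite subr0; apply.
apply: (@squeeze_cvgr _ _ _ _ (fun=> 0) (@harmonic R)); last 2 first.
- exact: cvg_cst.
- exact: cvg_harmonic.
near=> n; rewrite /harmonic invr_ge0 !mulr_ge0//= lef_pV2 ?posrE ?mulr_gt0//.
rewrite -[n.+3%:R]natr1 -[n.+2%:R]natr1.
have := ler0n R n; rewrite -[n.+1%:R]natr1; move: n%:R => x x0; nra.
Unshelve. all: by end_near. Qed.

Lemma offspring_subcritical : subcritical_offspring offspring.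
Proof.
split; first exact: offspring_ge0.
split; first exact: offspring_sum.
apply: (@le_lt_trans _ _ (2^-1)%:E); last by rewrite lte_fin; lra.
apply: lime_le.
  by apply: is_cvg_nneseries => k _ _; rewrite lee_fin mulr_ge0// offspring_ge0.
near=> n; rewrite sumEFin lee_fin (le_trans (offspring_mean_partial n))//.
have h : 0 <= (n.+2)%:R^-1 :> R by [].
by move: (n.+2%:R^-1) h => a; lra.
Unshelve. all: by end_near. Qed.

(** With x = 2^k the claim is x (x+1) (x+2) <= x^5 for x >= 2. At k = 1 the right side is 1/24, so 5
    is the least integer exponent that works. *)
Lemma offspring_dominates k : (0 < k)%N -> 2^-1 ^+ (5 * k) <= offspring (2 ^ k - 1).
Proof.
move=> k0; have k2 : (2 <= 2 ^ k)%N by rewrite -{1}(expn1 2) leq_exp2l.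
have [m E] : exists m, (2 ^ k - 1)%N = m.+1 by exists (2 ^ k - 2)%N; lia.
have xE : m.+2%:R = 2 ^+ k :> R by rewrite -natrX; congr (_%:R); lia.
have x2 : 2 <= 2 ^+ k :> R by rewrite -natrX ler_nat.
rewrite E /= -[m.+4%:R]natr1 -[m.+3%:R]natr1 xE mulnC exprM exprVn exprVn.
move: (2 ^+ k) x2 => x x2.
have x0 : 0 < x by lra.
rewrite lef_pV2 ?posrE ?exprn_gt0 ?mulr_gt0//; try lra.
have h1 : x + 1 <= x ^+ 2 by rewrite expr2; nra.
have h2 : x + 1 + 1 <= x ^+ 2 by rewrite expr2; nra.
rewrite -mulrA (_ : x ^+ 5 = x * (x ^+ 2 * x ^+ 2)); last by ring.
rewrite ler_pM2l//; apply: ler_pM => //; lra.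
Qed.

End offspring.

Section transfer.
Context {R : realType}.
Local Notation P := (@unit_prob R).

Lemma unif_law s (B : set R) : measurable B -> P (unif s @^-1` B) = P B.
Proof.
move=> mB; have := @unif_indep_nat R [:: s] (fun=> B) (fun=> mB) isT.
by rewrite !big_seq1.
Qed.

Lemma mutually_independent_preimage (f : R -> R) {I : eqType} (F G : I -> set (set R)) :
  (forall B, measurable B -> P (f @^-1` B) = P B) ->
  mutually_independent P F -> (forall i A, F i A -> measurable A) ->
  (forall i A, G i A -> exists2 A', F i A' & A = f @^-1` A') ->
  mutually_independent P G.
Proof.
move=> fP indF mF GF J A uJ GA.
have /choice[A' HA'] : forall i, exists A', i \in J -> F i A' /\ A i = f @^-1` A'.
  move=> i; have [iJ|_] := boolP (i \in J); last by exists setT.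
  by have [A' ? ?] := GF _ _ (GA _ iJ); exists A'.
have E : \big[setI/setT]_(i <- J) A i = f @^-1` (\big[setI/setT]_(i <- J) A' i).
  apply/seteqP; split => w; rewrite /= !bigsetI_seqP => H i iJ; have := H i iJ;
    by have [_ ->] := HA' i iJ.
rewrite E fP.
  rewrite indF//; last by move=> i iJ; have [] := HA' i iJ.
  apply: eq_big_seq => i iJ; have [Fi ->] := HA' i iJ.
  by rewrite fP//; exact: mF Fi.
rewrite big_seq; apply: bigsetI_measurable => i iJ.
by have [/mF] := HA' i iJ.
Qed.

(** Applied with [odd_bits], this keeps the law of the process and frees the even digits for the
    offspring variables. *)
Lemma marked_PPP_preimage dim n muR N U M (f : R -> R) :
  measurable_fun setT f -> (forall B, measurable B -> P (f @^-1` B) = P B) ->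
  is_marked_PPP P dim n muR N U M ->
  is_marked_PPP P dim n muR (N \o f) (fun i t => U i t \o f) (fun i => M i \o f).
Proof.
move=> mf fP PPP; have [[mN [mU mM]] PN PU PM indep] := PPP.
split.
- split; first by move=> k; exact: (measurable_preimage mf (mN k)).
  by split=> [i c|i]; exact: measurableT_comp.
- by move=> k; rewrite -PN; exact: (fP (N @^-1` [set k]) (mN k)).
- move=> i c B mB; rewrite -(PU i c B mB); exact: (fP (U i c @^-1` B) (measurable_preimage (mU i c) mB)).
- move=> i B mB; rewrite -(PM i B mB); exact: (fP (M i @^-1` B) (measurable_preimage (mM i) mB)).
- apply: (mutually_independent_preimage f _ _ fP indep) => [i A|].
    exact: (ppp_events_measurable PPP).
  move=> [[i [t|]]|] A /=.
  + by move=> [B mB ->]; exists (U i t @^-1` B) => //; exists B.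
  + by move=> [B mB ->]; exists (M i @^-1` B) => //; exists B.
  + by move=> [B ->]; exists (N @^-1` B) => //; exists B.
Qed.

Lemma affine_uniform n (B : set R) : (0 < n)%N -> measurable B ->
  P ((fun u => n%:R * u - n%:R / 2) @^-1` B) =
  (lebesgue_measure (B `&` `[(- (n%:R / 2))%R, (n%:R / 2)%R]) * (n%:R^-1)%:E)%E.
Proof.
move=> n0 mB; have n0R : 0 < n%:R :> R by rewrite ltr0n.
have ab : - (n%:R / 2) < n%:R / 2 :> R by lra.
have := uniform_lawE ab B mB; rewrite (_ : n%:R / 2 - - (n%:R / 2) = n%:R :> R); last lra.
move=> <-; rewrite -[LHS](congr1 P (setTI _)) -[RHS]mul1e.
apply: (law_ext P setT (fun u => n%:R * u - n%:R / 2) 1 (uniform_law ab)) => //.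
- by apply: measurable_funB => //; exact: measurable_funM.
- exact: probability_setT.
move=> x; rewrite setTI mul1e [RHS]uniform_lawE//.
rewrite (_ : _ @^-1` _ = `]-oo, x / n%:R + 2^-1]%classic); last first.
  apply/seteqP; split => u /=; rewrite !in_itv/=.
    by rewrite -lerBlDr ler_pdivlMr//; lra.
  by rewrite -lerBlDr ler_pdivlMr//; lra.
rewrite unit_law_cdf (_ : n%:R / 2 - - (n%:R / 2) = n%:R :> R); last lra.
have -> : `]-oo, x] `&` `[- (n%:R / 2), n%:R / 2] =
    `[- (n%:R / 2), Num.min (n%:R / 2) x]%classic :> set R.
  apply/seteqP; split => z /=; rewrite !in_itv/= le_min.
    by move=> [-> /andP[-> ->]].
  by move=> /and3P[-> -> ->].
rewrite lebesgue_measure_itv/= lte_fin.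
have [x1|x1] := leP (n%:R / 2) x.
  rewrite ab -EFinD -EFinM clamp_ge1; first by congr EFin; field; rewrite gt_eqF.
  by rewrite -lerBlDr ler_pdivlMr//; lra.
case: ltP => x2.
  rewrite -EFinD -EFinM clamp_id; first by congr EFin; field; rewrite gt_eqF.
  have lo : - 2^-1 <= x / n%:R by rewrite ler_pdivlMr//; lra.
  have hi : x / n%:R <= 2^-1 by rewrite ler_pdivrMr//; lra.
  by lra.
by rewrite mul0e clamp_le0// -lerBrDr ler_pdivrMr//; lra.
Qed.

Lemma marked_PPP_exists dim n (muR : probability R R) : (0 < n)%N ->
  exists N U M, is_marked_PPP P dim n muR N U M.
Proof.
move=> n0; have l0 : 0 < n%:R ^+ dim :> R by rewrite exprn_gt0// ltr0n.
have [z [mz Pz]] : exists z : R -> nat, (forall k, measurable (z @^-1` [set k])) /\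
    forall k, P (z @^-1` [set k]) = (poisson_pmf (n%:R ^+ dim) k)%:E.
  apply: discrete_sampling; first by move=> k; exact: poisson_pmf_ge0.
  have := @probability_setT _ _ _ (poisson_prob (n%:R ^+ dim : R) 0).
  rewrite nneseries_esumT; first by rewrite /= /poisson_prob l0.
  by move=> k; rewrite lee_fin poisson_pmf_ge0.
have [Q mQ PQ] := quantile_transform muR.
pose g u : R := n%:R * u - n%:R / 2.
have mg : measurable_fun setT g by apply: measurable_funB => //; exact: measurable_funM.
pose ix (x : ppp_index dim) := unif (R := R) (pickle x).
have mix x : measurable_fun setT (ix x) by exact: measurable_unif.
exists (z \o ix None), (fun i t => g \o ix (Some (i, Some t))), (fun i => Q \o ix (Some (i, None))).
split.
- split; first by move=> k; exact: (measurable_preimage (mix _) (mz k)).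
  by split=> [i t|i]; exact: measurableT_comp.
- by move=> k; rewrite -Pz; exact: (unif_law _ (z @^-1` [set k]) (mz k)).
- move=> i t B mB; rewrite -(affine_uniform n B n0 mB).
  exact: (unif_law _ (g @^-1` B) (measurable_preimage mg mB)).
- move=> i B mB; rewrite -PQ//.
  exact: (unif_law _ (Q @^-1` B) (measurable_preimage mQ mB)).
- apply: unif_mutually_independent => -[[i [t|]]|] A /=.
  + by move=> [B mB ->]; exists (g @^-1` B) => //; exact: (measurable_preimage mg mB).
  + by move=> [B mB ->]; exists (Q @^-1` B) => //; exact: (measurable_preimage mQ mB).
  + by move=> [B ->]; exists (z @^-1` B) => //; exact: nat_measurable_preimage.
Qed.

End transfer.

(** * Coupling with the Galton-Watson process *)

Section coupling.
Context {R : realType}.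
Local Notation P := (@unit_prob R).

Lemma law_partial (f : R -> nat) : nat_measurable f ->
  (fun n => \sum_(0 <= k < n) fine (P (f @^-1` [set k]))) @ \oo --> (1 : R).
Proof.
move=> mf; apply/nneseries_EFinP; first by move=> k; exact: fine_ge0.
rewrite -(@probability_setT _ _ _ P) (_ : setT = \bigcup_k (f @^-1` [set k])); last first.
  by apply/seteqP; split => // w _; exists (f w).
rewrite measure_semi_bigcup; first last.
- by apply: bigcupT_measurable => k; exact: mf.
- by apply/trivIsetP => i j _ _ ij; apply/seteqP; split => w //= -[Ni Nj];
    move: ij; rewrite -Ni -Nj eqxx.
- exact: mf.
by apply: eq_eseriesr => k _; rewrite fineK//; exact: fin_num_measure.
Qed.

(* [kappa] becomes the offspring number of the root after its zero value has been
   replaced by an independent variable carrying the missing mass of [p]. *)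
Lemma dominating_GW (p : nat -> R) (kappa : R -> nat) :
  (forall k, 0 <= p k) -> 0 < p 0%N -> (\sum_(0 <= k <oo) (p k)%:E = 1%:E)%E ->
  nat_measurable kappa ->
  (forall m, (0 < m)%N -> (P (kappa @^-1` [set m]) <= (p m)%:E)%E) ->
  exists xi, is_GW_family P p xi /\ forall w, (kappa (odd_bits w) <= xi 0%N 0%N w)%N.
Proof.
move=> p_ge0 p00 psum mk kp.
pose a m := fine (P (kappa @^-1` [set m])).
have aE m : P (kappa @^-1` [set m]) = (a m)%:E by rewrite fineK//; exact: fin_num_measure.
have a_ge0 m : 0 <= a m by exact: fine_ge0.
have ap m : (0 < m)%N -> a m <= p m by move=> m0; rewrite -lee_fin -aE; exact: kp.
have asum := law_partial kappa mk; rewrite -/a in asum.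
have /(nneseries_EFinP _ _ p_ge0) psum' := psum.
(* Both laws have mass 1 and [a] lies below [p] at positive values, so [a 0] is at least [p 0]. *)
have a00 : 0 < a 0%N.
  apply: (lt_le_trans p00); rewrite leNgt; apply/negP => a0p.
  have lt1 : 1 - (p 0%N - a 0%N) < 1 by lra.
  have [n _ /(_ n.+1 (leqnSn _)) an] := cvgr_gt _ asum _ lt1.
  have {}an : 1 - (p 0%N - a 0%N) < \sum_(0 <= k < n.+1) a k by exact: an.
  rewrite big_nat_recl// in an.
  have pn : \sum_(0 <= k < n.+1) p k <= 1.
    rewrite -lee_fin -psum -sumEFin.
    by apply: nneseries_lim_ge => k _; rewrite lee_fin.
  rewrite big_nat_recl// in pn.
  have : \sum_(0 <= i < n) a i.+1 <= \sum_(0 <= i < n) p i.+1.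
    by apply: ler_sum => i _; exact: ap.
  by move: an; lra.
(* The law that solves a(0) pi(m) + a(m) = p(m) for m > 0 and a(0) pi(0) = p(0). *)
pose pi m := if m is 0%N then p 0%N / a 0%N else (p m - a m) / a 0%N.
have pi_ge0 m : 0 <= pi m.
  by case: m => [|m] /=; apply: divr_ge0 => //; rewrite subr_ge0 ap.
have pisum : (\sum_(0 <= k <oo) (pi k)%:E = 1%:E)%E.
  apply/nneseries_EFinP => //; rewrite -cvg_shiftS.
  have E n : \sum_(0 <= k < n.+1) pi k =
      (\sum_(0 <= k < n.+1) p k - \sum_(0 <= k < n.+1) a k + a 0%N) / a 0%N.
    rewrite !big_nat_recl//= -mulr_suml sumrB -mulrDl; congr (_ / _); ring.
  under eq_fun do rewrite E.
  rewrite (_ : 1 = (1 - 1 + a 0%N) / a 0%N); last by rewrite subrr add0r divff// gt_eqF.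
  apply: cvgMl; apply: cvgD; last exact: cvg_cst.
  apply: cvgB.
    by move: psum'; rewrite -(cvg_shiftS (fun n => \sum_(0 <= k < n) p k)).
  by move: asum; rewrite -(cvg_shiftS (fun n => \sum_(0 <= k < n) a k)).
have [zp [mzp Pzp]] := discrete_sampling p p_ge0 psum.
have [zpi [mzpi Pzpi]] := discrete_sampling pi pi_ge0 pisum.
pose ix (x : option (nat * nat)) := unif (R := R) (pickle x).
have mix x : measurable_fun setT (ix x) by exact: measurable_unif.
pose z x : R -> nat := if x is Some _ then zp \o ix x else zpi \o ix x.
have mz x : nat_measurable (z x).
  by case: x => [x|] k /=; [exact: (measurable_preimage (mix (Some x)) (mzp k))|
    exact: (measurable_preimage (mix None) (mzpi k))].
have indz : mutually_independent P (fun x => nat_rv_events (z x)).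
  apply: unif_mutually_independent => -[x|] A [B ->] /=.
    by exists (zp @^-1` B) => //; exact: nat_measurable_preimage.
  by exists (zpi @^-1` B) => //; exact: nat_measurable_preimage.
have Pz0 m : P (z None @^-1` [set m]) = (pi m)%:E.
  by rewrite -Pzpi; exact: (unif_law _ (zpi @^-1` [set m]) (mzpi m)).
have PzS x m : P (z (Some x) @^-1` [set m]) = (p m)%:E.
  by rewrite -Pzp; exact: (unif_law _ (zp @^-1` [set m]) (mzp m)).
pose root w := if kappa (odd_bits w) == 0%N then z None (even_bits w) else kappa (odd_bits w).
pose xi t j : R -> nat := if (t, j) == (0%N, 0%N) then root else z (Some (t, j)) \o even_bits.
have rootP (B : set nat) (S : set R) : root @^-1` B `&` even_bits @^-1` S =
    (odd_bits @^-1` (kappa @^-1` [set 0%N]) `&` even_bits @^-1` (z None @^-1` B `&` S)) `|`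
    (odd_bits @^-1` (kappa @^-1` (B `\ 0%N)) `&` even_bits @^-1` S).
  apply/seteqP; split => w /=; rewrite /root.
    by case: eqP => k0 [Bk Sw]; [left|right].
  by case=> [[-> [? ?]]|[[Bk /eqP/negbTE ->] Sw]].
(* Where [kappa] vanishes the root reads even digits only, elsewhere odd digits only; this gives its
   joint law with any event [S] of the even digits. *)
have Proot (B : set nat) (S : set R) : measurable S ->
    P (root @^-1` B `&` even_bits @^-1` S) =
    (P (kappa @^-1` [set 0%N]) * P (z None @^-1` B `&` S) +
     P (kappa @^-1` (B `\ 0%N)) * P S)%E.
  move=> mS; have mk' C := nat_measurable_preimage kappa C mk.
  have mzB : measurable (z None @^-1` B `&` S).
    by apply: measurableI => //; exact: nat_measurable_preimage.
  have mo C := measurable_preimage measurable_odd_bits (mk' C).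
  have me (C : set R) (mC : measurable C) := measurable_preimage measurable_even_bits mC.
  rewrite rootP measureU; first last.
  - apply/seteqP; split => w //= -[[k0 _] [[_ k1] _]]; exact: k1.
  - by apply: measurableI; [exact: mo|exact: me].
  - by apply: measurableI; [exact: mo|exact: me].
  by congr (_ + _)%E; apply: bits_indep => //; exact: mk'.
have ProotT (B : set nat) : P (root @^-1` B) =
    (P (kappa @^-1` [set 0%N]) * P (z None @^-1` B) + P (kappa @^-1` (B `\ 0%N)))%E.
  have := Proot B setT measurableT; rewrite preimage_setT !setIT => ->.
  by rewrite probability_setT mule1.
have mroot : nat_measurable root.
  move=> k; have := rootP [set k] setT; rewrite preimage_setT !setIT => ->.
  have mo C := measurable_preimage measurable_odd_bits (nat_measurable_preimage kappa C mk).
  apply: measurableU; last exact: mo.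
  apply: measurableI; first exact: mo.
  exact: (measurable_preimage measurable_even_bits (mz None k)).
exists xi; split; last first.
  by move=> w; rewrite /xi eqxx /root; case: eqP => // ->.
have me (C : set R) (mC : measurable C) := measurable_preimage measurable_even_bits mC.
split.
- move=> t j k; rewrite /xi; case: ifP => _; first exact: mroot.
  exact: (me _ (mz (Some (t, j)) k)).
- move=> t j k; rewrite /xi; case: ifP => _; last first.
    by rewrite -(PzS (t, j)); exact: (even_bits_law _ (mz (Some (t, j)) k)).
  rewrite ProotT Pz0 aE; case: k => [|k].
    rewrite (_ : kappa @^-1` _ = set0) ?measure0 ?adde0; last first.
      by apply/seteqP; split => w //= -[-> ]; apply.
    by rewrite -EFinM mulrC divfK// gt_eqF.
  rewrite (_ : [set k.+1] `\ 0%N = [set k.+1]); last first.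
    by apply/seteqP; split => m //= [-> ]//.
  by rewrite aE -EFinM -EFinD mulrC divfK ?gt_eqF// subrK.
- move=> J A uJ JA.
  have /choice[B HB] : forall x, exists B : set nat, x \in J -> A x = xi x.1 x.2 @^-1` B.
    move=> x; have [xJ|_] := boolP (x \in J); last by exists setT.
    by have [B E] := JA x xJ; exists B.
  pose E (x : nat * nat) := z (Some x) @^-1` (B x).
  have mE x : measurable (E x) by exact: nat_measurable_preimage.
  have indE (L : seq (nat * nat)) : uniq L ->
      P (\big[setI/setT]_(x <- L) E x) = (\prod_(x <- L) P (E x))%E.
    move=> uL; pose A' y := if y is Some x then E x else setT.
    have := indz (map some L) A'; rewrite !big_map map_inj_uniq; last by move=> x y [].
    by apply=> // y /mapP[x _ ->]; exists (B x).
  have indE0 (L : seq (nat * nat)) (C : set nat) : uniq L ->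
      P (z None @^-1` C `&` \big[setI/setT]_(x <- L) E x) =
      (P (z None @^-1` C) * \prod_(x <- L) P (E x))%E.
    move=> uL; pose A' y := if y is Some x then E x else z None @^-1` C.
    have := indz (None :: map some L) A'; rewrite /= !big_cons !big_map map_inj_uniq; last by move=> x y [].
    apply; first by rewrite uL andbT; apply/negP => /mapP[].
    by move=> [x|] _; [exists (B x)|exists C].
  have AE x : x \in J -> x != (0%N, 0%N) -> A x = even_bits @^-1` (E x).
    move=> xJ x0; rewrite HB//; case: x x0 {xJ} => t j x0.
    by apply/funext => w; rewrite /preimage/= /xi (negbTE x0).
  have PA x : x \in J -> x != (0%N, 0%N) -> P (A x) = P (E x).
    by move=> xJ x0; rewrite AE//; exact: even_bits_law.
  have mbig (L : seq (nat * nat)) : measurable (\big[setI/setT]_(x <- L) E x).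
    by apply: bigsetI_measurable => x _; exact: mE.
  have bigE (L : seq (nat * nat)) : {subset L <= J} -> (0%N, 0%N) \notin L ->
      \big[setI/setT]_(x <- L) A x = even_bits @^-1` (\big[setI/setT]_(x <- L) E x).
    move=> LJ L0; apply/seteqP; split => w; rewrite /= !bigsetI_seqP => H x xL; have := H x xL;
      rewrite AE ?LJ//; by apply: contraNneq L0 => <-.
  have prodE (L : seq (nat * nat)) : {subset L <= J} -> (0%N, 0%N) \notin L ->
      (\prod_(x <- L) P (A x) = \prod_(x <- L) P (E x))%E.
    move=> LJ L0; apply: eq_big_seq => x xL; apply: PA; first exact: LJ.
    by apply: contraNneq L0 => <-.
  (* All variables except the root are functions of the even digits. If the root occurs, it is taken
     out first and [Proot] is applied with the event of the remaining indices as [S]. *)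
  have [J0|J0] := boolP ((0%N, 0%N) \in J); last first.
    rewrite bigE// prodE//; rewrite (even_bits_law _ (mbig J)).
    exact: indE.
  set L := rem (0%N, 0%N) J.
  have pJ : perm_eq J ((0%N, 0%N) :: L) by exact: perm_to_rem.
  have uL : uniq ((0%N, 0%N) :: L) by rewrite -(perm_uniq pJ).
  have LJ : {subset L <= J} by move=> x; exact: mem_rem.
  move: uL => /= /andP[L0 uL].
  rewrite !(perm_big _ pJ)/= !big_cons bigE// prodE// HB//=.
  have -> : xi 0%N 0%N @^-1` B (0%N, 0%N) = root @^-1` B (0%N, 0%N) by [].
  rewrite Proot// ProotT indE0// indE// muleA -ge0_muleDl//; last exact: mule_ge0.
Qed.

End coupling.

(** * The first covered level *)

Section first_covered.
Context {R : realType} {d : measure_display} {Om : measurableType d}.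
Variables (P : probability Om R) (K : nat) (C : nat -> set Om).
Hypothesis mC : forall k, measurable (C k).

Definition first_at i : set Om := C i `&` \big[setI/setT]_(l < i) ~` (C l).

Lemma first_at_measurable i : measurable (first_at i).
Proof.
apply: measurableI => //; apply: bigsetI_measurable => l _; exact: measurableC.
Qed.

Lemma first_atP i w : first_at i w <-> C i w /\ forall l, (l < i)%N -> ~ C l w.
Proof.
rewrite /first_at -(bigcap_mkord i (fun l => ~` (C l))).
by split=> -[Ci H]; split => // l; exact: H.
Qed.

(** At most one term of the sum is nonzero. The value is also 0 when no index below [K] is covered;
    only positive values have to be dominated. *)
Definition scale_value w : nat :=
  \sum_(i < K) (if `[< first_at i w >] then 2 ^ i - 1 else 0)%N.

Lemma scale_value_measurable : nat_measurable scale_value.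
Proof.
apply: (nat_measurable_sum (fun i w => if `[< first_at i w >] then 2 ^ i - 1 else 0)%N) => i k.
have -> : (fun w => if `[< first_at i w >] then 2 ^ i - 1 else 0)%N @^-1` [set k] =
    (first_at i `&` [set _ | (2 ^ i - 1)%N = k]) `|` (~` first_at i `&` [set _ | 0%N = k]).
  apply/seteqP; split => w /=.
    by case: asboolP => ? ?; [left|right].
  by case: asboolP => ?; case=> -[].
apply: measurableU; apply: measurableI; try exact: measurable_const_prop.
  exact: first_at_measurable.
by apply: measurableC; exact: first_at_measurable.
Qed.

Lemma scale_valueE i w : (i < K)%N -> first_at i w -> scale_value w = (2 ^ i - 1)%N.
Proof.
move=> iK fi; rewrite /scale_value (bigD1 (Ordinal iK))//= (asboolT fi) big1 ?addn0//.
move=> l li; rewrite asboolF// => /first_atP[Cl Hl].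
have /first_atP[Ci Hi] := fi.
have [E|E|E] := ltngtP l i; [exact: (Hi l)|exact: (Hl i)|].
by move/eqP: li; apply; exact/val_inj.
Qed.

Lemma first_at_exists i w : C i w -> exists2 l, (l <= i)%N & first_at l w.
Proof.
move=> Ci; have ex : exists l, `[< C l w >] by exists i; exact/asboolP.
case: (ex_minnP ex) => l /asboolP Cl lmin; exists l.
  by apply: lmin; exact/asboolP.
by apply/first_atP; split => // m ml Cm; have := lmin m (asboolT Cm); lia.
Qed.

Lemma scale_value_pos w : (0 < scale_value w)%N ->
  exists i, [/\ (0 < i < K)%N, scale_value w = (2 ^ i - 1)%N & ~ C i.-1 w].
Proof.
move=> pos; have [H|H] := pselect (exists2 i, (i < K)%N & first_at i w); last first.
  move: pos; rewrite /scale_value big1// => i _; rewrite asboolF// => fi.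
  by apply: H; exists i.
have [i iK fi] := H; have E := scale_valueE i w iK fi.
have i0 : (0 < i)%N by rewrite lt0n; apply/eqP => i0; move: pos; rewrite E i0.
exists i; rewrite i0 iK; split => //.
by have /first_atP[_] := fi; apply; rewrite prednK.
Qed.

(** A positive value [2 ^ i - 1] means that index [i.-1] was not yet covered, an event of
    probability at most 2^(-5i). *)
Lemma scale_value_law m : (0 < m)%N ->
  (forall i, (0 < i < K)%N -> (P (~` C i.-1) <= (2^-1 ^+ (5 * i))%:E)%E) ->
  (P (scale_value @^-1` [set m]) <= (offspring m)%:E)%E.
Proof.
move=> m0 H; have mS := scale_value_measurable m.
have [[i [iK mE]]|N] := pselect (exists i, (0 < i < K)%N /\ m = (2 ^ i - 1)%N); last first.
  rewrite (_ : _ @^-1` _ = set0) ?measure0 ?lee_fin ?offspring_ge0//.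
  apply/seteqP; split => w //= E; apply: N.
  by have [|i [iK E' _]] := scale_value_pos w; [rewrite E|exists i; rewrite -E].
apply: (@le_trans _ _ (2^-1 ^+ (5 * i))%:E); last first.
  by rewrite lee_fin mE; apply: offspring_dominates; case/andP: iK.
apply: le_trans (H i iK); apply: le_measure; rewrite ?inE//.
  exact: measurableC.
move=> w /= E; have [|l [lK E' Cl]] := scale_value_pos w; first by rewrite E.
suff -> : i = l by [].
apply: (@expnI 2) => //; move: E'; rewrite E mE.
have : (0 < 2 ^ i)%N by rewrite expn_gt0.
have : (0 < 2 ^ l)%N by rewrite expn_gt0.
by lia.
Qed.

End first_covered.

(** * Choice of scales and conclusion *)

Lemma tail_lower_bound {R : realType} (dim : nat) (muR : probability R R) (beta b : R) :
  (h ^+ dim * fine (muR `]h, +oo[%classic)) @[h --> +oo] --> beta -> b < beta ->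
  exists2 H0 : R, 0 < H0 & forall h, H0 <= h -> b <= h ^+ dim * tail (muR := muR) h.
Proof.
move=> /cvgr_gt H /H[M [_ HM]]; exists (Num.max 1 (M + 1)).
  by rewrite lt_max ltr01.
move=> h; rewrite ge_max => /andP[_ Mh]; apply/ltW/HM; lra.
Qed.

Lemma covered_in_box_prob {R : realType} {d : measure_display} {Om : measurableType d}
    (P : probability Om R) (dim n : nat) (muR : probability R R)
    (N : Om -> nat) (U : nat -> 'I_dim -> Om -> R) (M : nat -> Om -> R) k (H0 : R) :
  (0 < n)%N -> (2 <= dim)%N -> is_marked_PPP P dim n muR N U M -> 0 < H0 ->
  (forall h, H0 <= h -> dim%:R `^ (dim%:R / 2) * 2 ^+ (2 * dim + 1) * dim.+1%:R * ln 2 <=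
    h ^+ dim * tail (muR := muR) h) ->
  H0 * 2 ^+ k <= n%:R ->
  (P (~` covered (n := n) (N := N) (U := U) (M := M) k `|` ~` in_box (n := n) (U := U))
    <= (2^-1 ^+ (5 * k))%:E)%E.
Proof.
move=> n0 dim2 PPP H00 Ht nk; have dim0 : (0 < dim)%N by exact: leq_trans dim2.
have mc := covered_measurable n0 PPP k.
have mb := in_box_measurable n0 PPP.
apply: (le_trans (measureU2 _ (measurableC mc) (measurableC mb))).
have -> : (P (~` covered (n := n) (N := N) (U := U) (M := M) k) + P (~` in_box (n := n) (U := U)) =
  P (~` covered (n := n) (N := N) (U := U) (M := M) k))%E.
  by rewrite (in_box_prob n0 PPP) adde0.
exact: (uncovered_small n0 dim0 PPP k H0 H00 Ht nk dim2).
Qed.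

(** [K] is the largest level with h 2^K <= n; by maximality n < h 2^(K+1), so already 2^(-K) is of
    order 1/n. *)
Lemma trunc_log_scale {R : realType} h n : (0 < h)%N -> (h <= n)%N ->
  let K := trunc_log 2 (n %/ h) in
  h%:R * 2 ^+ K <= n%:R :> R /\ 2^-1 ^+ (5 * K) <= (2 * h)%:R / n%:R :> R.
Proof.
move=> h0 hn K; have nh : (0 < n %/ h)%N by rewrite divn_gt0.
have n0 : (0 < n)%N by exact: leq_trans hn.
have /andP[lo hi] := trunc_log_bounds (isT : (1 < 2)%N) nh.
rewrite -/K in lo hi; split.
  rewrite -natrX -natrM ler_nat mulnC.
  by apply: leq_trans (leq_trunc_div n h); rewrite leq_mul2r lo orbT.
apply: (@le_trans _ _ (2^-1 ^+ K)).
  by apply: ler_wiXn2l; [lra|lra|rewrite leq_pmull].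
rewrite exprVn ler_pdivlMr ?ltr0n// mulrC ler_pdivrMr ?exprn_gt0//.
rewrite -natrX -natrM ler_nat.
have := ltn_ceil n h0; rewrite -ltn_divLR// in hi *.
have : (n < 2 ^ K.+1 * h)%N by rewrite -ltn_divLR.
by rewrite expnS; nia.
Qed.

Theorem theorem2p6 (R : realType) (dim : nat) (muR : probability R R) (beta : R) :
  (2 <= dim)%N ->
  (* R >= 0 a.s. *)
  muR `]-oo, 0[%classic = 0%E ->
  (* absolutely continuous law of R *)
  muR `<< (@lebesgue_measure R) ->
  0 < beta ->
  (* lim_{h -> oo} h^s P(R > h) = beta, with s = d *)
  (h ^+ dim * fine (muR `]h, +oo[%classic)) @[h --> +oo] --> beta ->
  (* beta > d^{d/2} 2^{2d+1} (d+1) log 2 *)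
  (dim%:R `^ (dim%:R / 2)) * 2 ^+ (2 * dim + 1) * (dim.+1)%:R * ln 2 < beta ->
  (* connectivity with probability tending to 1 *)
  (forall eps : R, 0 < eps -> exists n0 : nat, forall n : nat, (n0 <= n)%N ->
     forall (d0 : measure_display) (Om : measurableType d0)
       (P : probability Om R) (N : Om -> nat)
       (U : nat -> 'I_dim -> Om -> R) (M : nat -> Om -> R),
     is_marked_PPP P dim n muR N U M ->
     ((1 - eps)%:E <= P [set w | gconnected n (marked_config N U M w)])%E)
  /\
  (* coupling with the total progeny of a subcritical GW process *)
  (exists p : nat -> R, subcritical_offspring p /\
   exists C : R, exists n0 : nat, forall n : nat, (n0 <= n)%N ->
     exists (d0 : measure_display) (Om : measurableType d0)
       (P : probability Om R) (N : Om -> nat)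
       (U : nat -> 'I_dim -> Om -> R) (M : nat -> Om -> R)
       (xi : nat -> nat -> Om -> nat),
     is_marked_PPP P dim n muR N U M /\ is_GW_family P p xi /\
     (P [set w | exists m : nat, gw_total_progeny xi w m /\
          ~ diam_le n (marked_config N U M w) (2 + 2 ^ dim * m)]
        <= (C / n%:R)%:E)%E).
Proof.
move=> dim2 _ _ _ /tail_lower_bound Hb bbeta; have [H0 H00 Ht] := Hb _ bbeta.
pose h := (Num.truncn H0).+1.
have hH : H0 <= h%:R by apply/ltW; exact: truncnS_gt.
have h0 : (0 < h)%N by [].
split=> [eps e0|].
  have [k _ /(_ k (leqnn k))] := near_infty_natSinv_expn_lt (PosNum e0).
  rewrite div1r -exprVn /= => ke.
  exists (h * 2 ^ k)%N => n hn d0 Om P N U M PPP.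
  have n0 : (0 < n)%N by apply: leq_trans hn; rewrite muln_gt0 h0 expn_gt0.
  have nk : H0 * 2 ^+ k <= n%:R.
    apply: (@le_trans _ _ (h%:R * 2 ^+ k)); first by rewrite ler_pM2r// exprn_gt0.
    by rewrite -natrX -natrM ler_nat.
  have [[mN [mU mM]] _ _ _ _] := PPP.
  have mG := gconnected_measurable n mN mU mM.
  have mc := covered_measurable n0 PPP k.
  have mb := in_box_measurable n0 PPP.
  have Q := covered_in_box_prob P dim n muR N U M k H0 n0 dim2 PPP H00 Ht nk.
  have sub : ~` [set w | gconnected n (marked_config N U M w)] `<=`
      ~` covered (n := n) (N := N) (U := U) (M := M) k `|` ~` in_box (n := n) (U := U).
    rewrite -setCI; apply: subsetC => w [cw bw]; apply: (diam_le_gconnected n (2 + 2 ^ k)).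
    exact: covered_in_box_diam.
  have PC : (P (~` [set w | gconnected n (marked_config N U M w)]) <= eps%:E)%E.
    apply: (le_trans (le_measure P _ _ sub)); rewrite ?inE.
    - exact: measurableC.
    - by apply: measurableU; exact: measurableC.
    apply: (le_trans Q); rewrite lee_fin (le_trans _ (ltW ke))//.
    by apply: ler_wiXn2l; [lra|lra|rewrite leq_pmull].
  rewrite -[X in P X]setCK probability_setC; last exact: measurableC.
  by rewrite EFinB; apply: leeB.
exists offspring; split; first exact: offspring_subcritical.
exists (2 * h)%:R, h => n hn.
have n0 : (0 < n)%N by exact: leq_trans hn.
pose P := @unit_prob R.
have [N [U [M PPP]]] := marked_PPP_exists dim n muR n0.
have PPP' := marked_PPP_preimage dim n muR N U M odd_bits measurable_odd_bits
  (fun B => odd_bits_law B) PPP.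
have [nK Kn] := @trunc_log_scale R h n h0 hn.
set K := trunc_log 2 (n %/ h) in nK Kn.
have small i : (i <= K)%N -> H0 * 2 ^+ i <= n%:R.
  move=> iK; apply: le_trans nK; apply: (@le_trans _ _ (h%:R * 2 ^+ i)).
    by rewrite ler_pM2r// exprn_gt0.
  by rewrite ler_pM2l ?ltr0n// ler_eXn2l ?ltr1n.
pose cov k : set R := covered (n := n) (N := N) (U := U) (M := M) k.
pose box : set R := in_box (n := n) (U := U).
have mcov k : measurable (cov k) by exact: (covered_measurable n0 PPP k).
have mbox : measurable box by exact: (in_box_measurable n0 PPP).
have dim0 : (0 < dim)%N by exact: leq_trans dim2.
have Pcov k : (k <= K)%N -> (P (~` cov k) <= (2^-1 ^+ (5 * k))%:E)%E.
  by move=> /small nk; exact: (uncovered_small n0 dim0 PPP k H0 H00 Ht nk dim2).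
(* The shift by one makes [kappa] equal to [2 ^ i - 1] when [i.+1] is the first covered level, so
   level 1 corresponds to [kappa = 0]. *)
pose C i := cov i.+1.
pose kappa := scale_value K C.
have mkappa : nat_measurable kappa by apply: scale_value_measurable => i; exact: mcov.
have [xi [GW kxi]] : exists xi, is_GW_family P offspring xi /\
    forall w, (kappa (odd_bits w) <= xi 0%N 0%N w)%N.
  apply: dominating_GW => //.
  - exact: offspring_ge0.
  - by rewrite /=; lra.
  - exact: offspring_sum.
  move=> m m0; apply: scale_value_law => // [i|i /andP[i0 iK]]; first exact: mcov.
  by rewrite /C prednK//; apply: Pcov; exact: ltnW.
exists _, R, P, (N \o odd_bits), (fun i t => U i t \o odd_bits), (fun i => M i \o odd_bits), xi.
split=> //; split=> //.
have [mxi _ _] := GW.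
have [[mN' [mU' mM']] _ _ _ _] := PPP'.
have mbad : measurable [set w | exists m, gw_total_progeny xi w m /\
    ~ diam_le n (marked_config (N \o odd_bits) (fun i t => U i t \o odd_bits)
      (fun i => M i \o odd_bits) w) (2 + 2 ^ dim * m)].
  rewrite (_ : mkset _ = \bigcup_m ([set w | gw_total_progeny xi w m] `&`
      ~` [set w | diam_le n (marked_config (N \o odd_bits) (fun i t => U i t \o odd_bits)
      (fun i => M i \o odd_bits) w) (2 + 2 ^ dim * m)])).
    apply: bigcupT_measurable => m; apply: measurableI.
      exact: gw_total_progeny_measurable.
    by apply: measurableC; exact: (diam_le_measurable n mN' mU' mM').
  by apply/seteqP; split => w /= [m]; [move=> [? ?]; exists m|move=> _ [? ?]; exists m].
have mS : measurable (~` cov K `|` ~` box).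
  by apply: measurableU; exact: measurableC.
have sub : [set w | exists m, gw_total_progeny xi w m /\
    ~ diam_le n (marked_config (N \o odd_bits) (fun i t => U i t \o odd_bits)
      (fun i => M i \o odd_bits) w) (2 + 2 ^ dim * m)] `<=`
    odd_bits @^-1` (~` cov K `|` ~` box).
  move=> w [m [prog ndiam]]; rewrite /preimage /= -not_andP => -[cK bw]; apply: ndiam.
  (* Without any level no cell can be covered, so [cov 0] is empty. *)
  have K0 : (0 < K)%N.
    rewrite lt0n; apply/eqP => K0; rewrite /cov K0 in cK.
    have [|? [? [_ //]]] := coveredP _ _ cK (fun=> 0%N).
    by [].
  have [i iK fi] : exists2 l, (l <= K.-1)%N & first_at C l (odd_bits w).
    by apply: first_at_exists; rewrite /C prednK.
  have iK' : (i < K)%N by rewrite -ltnS prednK in iK.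
  have ki : kappa (odd_bits w) = (2 ^ i - 1)%N by exact: scale_valueE.
  have /first_atP[ci _] := fi.
  have dl : diam_le n (marked_config N U M (odd_bits w)) (2 + 2 ^ i.+1).
    by apply: covered_in_box_diam.
  have := gw_total_progeny_ge xi w m prog; have := kxi w; rewrite ki => kx xm.
  (* Covering at level [i.+1] costs 2 * 2^i, where 2^i <= [m] because the root has at least 2^i - 1
     children, and 2 <= 2^dim. *)
  apply: diam_le_leq dl; rewrite leq_add2l expnS.
  have d2 : (2 <= 2 ^ dim)%N by rewrite -{1}(expn1 2) leq_exp2l.
  have i1 : (0 < 2 ^ i)%N by rewrite expn_gt0.
  apply: leq_mul => //; lia.
apply: (le_trans (le_measure P _ _ sub)); rewrite ?inE//.
  exact: (measurable_preimage measurable_odd_bits mS).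
apply: (@le_trans _ _ (P (~` cov K `|` ~` box))).
  by rewrite le_eqVlt; apply/orP; left; apply/eqP; exact: (odd_bits_law _ mS).
apply: (le_trans (covered_in_box_prob P dim n muR N U M K H0 n0 dim2 PPP H00 Ht (small K (leqnn K)))).
by rewrite lee_fin.
Qed.
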